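(* There is an absolute constant $0<c<1$ such that \[ \deg_{I_0,I_1,I_*}((f\circ\mathrm{MP}^*_m)|_{\le\theta})\ge\min\left\{cm\deg_{I_0,I_1,I_*}(f),\ \frac{c\theta}{m\log(n+m)}-n\right\}, \] \[ \deg_{I_0,I_1,I_*}((f\circ\neg\mathrm{MP}^*_m)|_{\le\theta})\ge\min\left\{cm\deg_{I_0,I_1,I_*}(f),\ \frac{c\theta}{m\log(n+m)}-n\right\} \] for all positive integers $n,m,\theta$, all functions $f\colon\{0,1\}^n\to\{0,1,*\}$, and all nonempty convex sets $I_0,I_1,I_*\subseteq\mathbb{R}$.
   Context: For a (partial) function $g\colon X\to\{0,1,*\}$ on a finite $X\subset\mathbb{R}^N$, an $(I_0,I_1,I_* )$-approximant is a real polynomial mapping $g^{-1}(0),g^{-1}(1),g^{-1}( * )$ into $I_0,I_1,I_*$ respectively, and $\deg_{I_0,I_1,I_*}(g)$ is the least degree of such an approximant. $\mathrm{MP}^*_m\colon\{0,1,\dots,m^2\}^m\to\{0,1\}$ is given by $\mathrm{MP}^*_m(t_1,\dots,t_m)=1$ iff $t_i\ge1$ for all $i$, and $\neg\mathrm{MP}^*_m=1-\mathrm{MP}^*_m$. The composition $f\circ g$ on $(\{0,1,\dots,m^2\}^m)^n\subseteq\mathbb{N}^{nm}$ is $(f\circ g)(y_1,\dots,y_n)=f(g(y_1),\dots,g(y_n))$. For $h$ on a subset of $\mathbb{N}^{N}$, $h|_{\le\theta}$ is its restriction to inputs $x$ with $\sum_ix_i\le\theta$. Logarithms base 2. *)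

(* Defs.v *)
From HB Require Import structures.
From mathcomp Require Import all_boot all_order all_algebra.
From mathcomp Require Import -(notations) mpoly.
From mathcomp Require Import boolp classical_sets reals convex exp.

Set Implicit Arguments.
Unset Strict Implicit.
Unset Printing Implicit Defensive.

Import Order.TTheory GRing.Theory Num.Theory.
Local Open Scope classical_set_scope.
Local Open Scope ring_scope.

(* The value set {0,1,*} is [option bool], with [None] standing for *.  *)
Definition target (R : realType) (I0 I1 Is : set R) (a : option bool) : set R :=
  match a with Some false => I0 | Some true => I1 | None => Is end.

(* msize is the total degree plus one, and 0 at the zero polynomial, so the    *)
(* zero polynomial is given degree 0.                                          *)
Definition totdeg (R : realType) (N : nat) (p : mpoly N R) : nat :=
  (mpoly.msize p).-1.

(* A function on a finite subset of R^N is given by a finite alphabet S with   *)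
(* an injective reading v : S -> R of its letters as reals, a domain X of      *)
(* words over S, and values g of which only those on X matter; a word x is the *)
(* real point map_mx v x.                                                      *)
Definition approximant (R : realType) (I0 I1 Is : set R) (S : finType)
    (v : S -> R) (N : nat) (X : {set 'rV[S]_N}) (g : 'rV[S]_N -> option bool)
    (p : mpoly N R) : Prop :=
  forall x, x \in X ->
    target I0 I1 Is (g x) (meval (map_mx v x 0) p).

Definition is_approx_deg (R : realType) (I0 I1 Is : set R) (S : finType)
    (v : S -> R) (N : nat) (X : {set 'rV[S]_N}) (g : 'rV[S]_N -> option bool)
    (d : nat) : Prop :=
  (exists2 p, approximant I0 I1 Is v X g p & totdeg p = d) /\
  (forall p, approximant I0 I1 Is v X g p -> (d <= totdeg p)%N).

(* The default 0 is not reached for nonempty I0, I1, Is: see approx_degP.      *)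
Definition approx_deg (R : realType) (I0 I1 Is : set R) (S : finType)
    (v : S -> R) (N : nat) (X : {set 'rV[S]_N}) (g : 'rV[S]_N -> option bool)
    : nat :=
  xget 0%N [set d | is_approx_deg I0 I1 Is v X g d].

Definition bool_val (R : realType) (b : bool) : R := b%:R.
Definition ord_val (R : realType) (k : nat) (i : 'I_k) : R := i%:R.

Definition deg_cube (R : realType) (I0 I1 Is : set R) (n : nat)
    (f : 'rV[bool]_n -> option bool) : nat :=
  approx_deg I0 I1 Is (@bool_val R) [set: 'rV[bool]_n]%SET f.

Definition weight_le (k N theta : nat) : {set 'rV['I_k]_N} :=
  [set x : 'rV['I_k]_N | (\sum_(i < N) x ord0 i <= theta)%N]%SET.

Definition deg_le (R : realType) (I0 I1 Is : set R) (k N theta : nat)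
    (h : 'rV['I_k]_N -> option bool) : nat :=
  approx_deg I0 I1 Is (@ord_val R k) (weight_le k N theta) h.

Definition MPstar (m : nat) (t : 'rV['I_(m ^ 2).+1]_m) : bool :=
  [forall i, (1 <= t ord0 i)%N].

Definition negMPstar (m : nat) (t : 'rV['I_(m ^ 2).+1]_m) : bool :=
  ~~ MPstar t.

(* The input of length n * m is the concatenation of the n rows y_1, ..., y_n  *)
(* of vec_mx y.                                                                *)
Definition block_comp (S : Type) (n m : nat) (f : 'rV[bool]_n -> option bool)
    (g : 'rV[S]_m -> bool) (y : 'rV[S]_(n * m)) : option bool :=
  f (\row_(i < n) g (row i (vec_mx y))).

Definition log2 (R : realType) (x : R) : R := ln x / ln 2.

Lemma approximant_exists (R : realType) (I0 I1 Is : set R) (S : finType)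
    (v : S -> R) (N : nat) (X : {set 'rV[S]_N}) (g : 'rV[S]_N -> option bool) :
  injective v -> I0 !=set0 -> I1 !=set0 -> Is !=set0 ->
  exists p, approximant I0 I1 Is v X g p.
Proof.
move=> vinj [a0 I0a] [a1 I1a] [a2 Isa].
pose a b := match b with Some false => a0 | Some true => a1 | None => a2 end.
have aP b : target I0 I1 Is b (a b) by case: b => [[]|].
pose q (z : 'rV[S]_N) : mpoly N R := \sum_(i < N)
  (mpolyX R (mnm1 i) - mpolyC N (v (z 0 i))) ^+ 2.
have qE z x : meval (map_mx v x 0) (q z) =
    \sum_(i < N) (v (x 0 i) - v (z 0 i)) ^+ 2.
  rewrite rmorph_sum; apply: eq_bigr => i _ /=.
  by rewrite rmorphXn rmorphB /= mevalXU mevalC mxE.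
have q0 z : meval (map_mx v z 0) (q z) = 0.
  by rewrite qE big1 // => i _; rewrite subrr expr0n.
have qn0 z x : z != x -> meval (map_mx v x 0) (q z) != 0.
  apply: contra_neq; rewrite qE => /eqP.
  rewrite psumr_eq0 => [/allP h|i _]; last exact: sqr_ge0.
  apply/rowP => i; apply: vinj; apply/esym/eqP.
  by have := h i (mem_index_enum i); rewrite /= sqrf_eq0 subr_eq0.
pose Q x := \prod_(z | z != x) q z.
pose ev (x : 'rV[S]_N) := meval (map_mx v x 0).
have Q0 x y : x != y -> ev y (Q x) = 0.
  move=> xy; rewrite /ev rmorph_prod (bigD1 y) 1?eq_sym//=.
  by rewrite q0 mul0r.
have Qn0 x : ev x (Q x) != 0.
  by rewrite /ev rmorph_prod; apply/prodf_neq0 => z; exact: qn0.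
exists (\sum_x mpolyC N (a (g x) / ev x (Q x)) * Q x) => x _.
rewrite raddf_sum (bigD1 x)//= big1 ?addr0.
  by rewrite rmorphM /= mevalC divfK //; apply: Qn0.
by move=> z zx; rewrite rmorphM /= [X in _ * X]Q0 ?mulr0.
Qed.

Lemma approx_degP (R : realType) (I0 I1 Is : set R) (S : finType)
    (v : S -> R) (N : nat) (X : {set 'rV[S]_N}) (g : 'rV[S]_N -> option bool) :
  injective v -> I0 !=set0 -> I1 !=set0 -> Is !=set0 ->
  is_approx_deg I0 I1 Is v X g (approx_deg I0 I1 Is v X g).
Proof.
move=> vinj I0n I1n Isn.
have [p pP] := approximant_exists X g vinj I0n I1n Isn.
pose D d := `[< exists2 p, approximant I0 I1 Is v X g p & totdeg p = d >].
have exD : exists d, D d by exists (totdeg p); apply/asboolP; exists p.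
case: (ex_minnP exD) => d /asboolP dP dmin.
apply: (@xgetPex _ 0%N [set d | is_approx_deg I0 I1 Is v X g d]).
exists d; split => // r rP.
by apply: dmin; apply/asboolP; exists r.
Qed.

Lemma bool_val_inj (R : realType) : injective (@bool_val R).
Proof. by move=> [] [] //= /eqP; rewrite /bool_val eqr_nat. Qed.

Lemma ord_val_inj (R : realType) (k : nat) : injective (@ord_val R k).
Proof. by move=> i j /eqP; rewrite eqr_nat => /eqP /val_inj. Qed.

(* Main.v *)
Require Import Defs.
From HB Require Import structures.
From mathcomp Require Import all_boot all_order all_algebra.
From mathcomp Require Import -(notations) mpoly.
From mathcomp Require Import boolp classical_sets reals convex exp.
From mathcomp Require Import sequences interval_inference.
From mathcomp Require Import zify ring lra.

Set Implicit Arguments.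
Unset Strict Implicit.
Unset Printing Implicit Defensive.

Import Order.TTheory GRing.Theory Num.Theory.
Local Open Scope classical_set_scope.
Local Open Scope ring_scope.

(* An approximant p of f o MP* is pulled back along random inputs: for         *)
(* z in {0,1}^n draw the i-th block from L_{z_i}, where L_0, L_1 live on the   *)
(* zeros and ones of MP* and agree on all polynomials of degree <= d = m / 128.*)
(* The expectation of p is then a multilinear polynomial in z in which every   *)
(* variable costs degree d + 1, and convexity keeps it in I_0, I_1, I_*.       *)
(*                                                                            *)
(* L_0, L_1 come from measures A, B on {1, .., m^2} with delta_0 + A = B on    *)
(* degree <= d and A light: L_1 = B^m up to the tiny correction replacing A^m, *)
(* and L_0 = (delta_0 + A)^m - A^m. Since A and B decay like                  *)
(* t^-2 exp(-t / O(m)), the product measure rarely exceeds weight theta; there *)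
(* a point is replaced, through Newton's interpolation formula in its few      *)
(* large coordinates, by nearby points of small weight, which changes no       *)
(* moment of order <= deg p and at most doubles the mass of any point.         *)

(** * Finite differences and the one-dimensional measures *)

(** Let p be an approximant of least degree D for the restricted composition. If the second term of
    the minimum is at most D there is nothing to prove. Otherwise theta is at least of order (D + n)
    m ln(n + m), and then p yields an approximant q of f with (deg q) (d + 1) <= D, where d is m /
    128 rounded down.

    One dimension: normalised weights (-1)^i 'C(2M, M + i) at the nodes K i^2, with M = d, form a
    finite difference of order 2M. They annihilate degree below M and are Gaussian in i, hence
    exponentially small in t = K i^2 at scale m. Dividing by (t - 1) (t - Q) adds the decay t^-2 and
    puts nearly all mass away from 0 at t = 1 ([omega_exists]). Splitting into nonnegative parts
    gives A and B ([base_pair]), and products of these give the block distributions L_0, L_1 with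
    equal moments up to degree d ([block_dual]).

    Many blocks: put L_z = prod_i L_{z_i} and expand L_{z_i} = L_0 + z_i (L_1 - L_0). The term with
    L_1 - L_0 in the blocks of U annihilates every monomial of degree at most d in one of these
    blocks, so only terms with |U| (d + 1) <= D survive in q(z) = E_{L_z} p ([transfer]).

    Small weight: [truncation] replaces L_z by a nonnegative measure on inputs of weight at most
    theta with the same moments up to order D. So q(z) is an average of values of p at admissible
    inputs where the composition equals f(z), and convexity puts it in the right set. The mass
    arriving at a point is controlled by a union bound over the sets of large coordinates; the
    harmonic sum of the thresholds for largeness produces the logarithm. *)

Lemma sum_alt_bin_pow (R : comNzRingType) (a e : nat) (c : R) : (e < a)%N ->
  \sum_(b < a.+1) (-1) ^+ b * 'C(a, b)%:R * (b%:R + c) ^+ e = 0.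
Proof.
elim: a e c => // a IH e c; rewrite ltnS => lea.
(* Pascal's rule: the difference of order a + 1 is a difference of two sums of order a shifted by 1,
   and x^e - (x + 1)^e has degree below e. *)
have -> : \sum_(b < a.+2) (-1) ^+ b * 'C(a.+1, b)%:R * (b%:R + c) ^+ e =
  \sum_(b < a.+1) (-1) ^+ b * 'C(a, b)%:R * (b%:R + c) ^+ e -
  \sum_(b < a.+1) (-1) ^+ b * 'C(a, b)%:R * (b%:R + c + 1) ^+ e.
  rewrite big_ord_recl [X in X - _]big_ord_recl /= !bin0 -addrA; congr (_ + _).
  pose G (i : nat) : R := (-1) ^+ i.+1 * 'C(a, i.+1)%:R * (i.+1%:R + c) ^+ e.
  have -> : \sum_(i < a) (-1) ^+ bump 0 i * 'C(a, bump 0 i)%:R *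
      ((bump 0 i)%:R + c) ^+ e = \sum_(i < a.+1) G i.
    rewrite big_ord_recr /= {2}/G bin_small // mulr0 mul0r addr0.
    by apply: eq_bigr => i _; rewrite /bump leq0n add1n.
  rewrite -sumrB; apply: eq_bigr => i _; rewrite /G /bump leq0n add1n binS.
  have -> : i%:R + c + 1 = i.+1%:R + c by rewrite -natr1; ring.
  by rewrite !natrD !exprS; ring.
rewrite -sumrB.
under eq_bigr do rewrite -mulrBr.
have dpow (x : R) : x ^+ e - (x + 1) ^+ e = - \sum_(j < e) x ^+ j *+ 'C(e, j).
  rewrite addrC [x + 1]addrC exprDn big_ord_recr /= binn mulr1n expr1n mul1r.
  under eq_bigr do rewrite expr1n mul1r.
  rewrite opprD; ring.
under eq_bigr do rewrite dpow mulrN mulr_sumr.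
rewrite sumrN exchange_big big1 ?oppr0 // => j _.
transitivity ((\sum_(b < a.+1) (-1) ^+ b * 'C(a, b)%:R * (b%:R + c) ^+ j) *
    'C(e, j)%:R).
  by rewrite mulr_suml; apply: eq_bigr => b _; rewrite [RHS]mulr_natr [LHS]mulrnAr.
by rewrite IH ?mul0r // (leq_trans (ltn_ord j)).
Qed.

Lemma sum_symmetric_ord (R : nmodType) (M : nat) (F : nat -> R) :
  (forall i, (i <= M)%N -> F (M - i)%N = F (M + i)%N) ->
  \sum_(l < (2 * M).+1) F l = F M + \sum_(i < M) F (M + i.+1)%N *+ 2.
Proof.
move=> sF; rewrite -(big_mkord predT) (big_cat_nat (n := M)) //=; last lia.
rewrite [X in _ + X]big_ltn; last lia.
rewrite addrCA; congr (_ + _).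
under [RHS]eq_bigr do rewrite mulr2n.
rewrite big_split /=; congr (_ + _).
  rewrite big_nat_rev big_mkord; apply: eq_bigr => i _.
  by rewrite add0n sF.
rewrite -[M.+1]add0n big_addn.
have -> : ((2 * M).+1 - M.+1 = M)%N by lia.
by rewrite big_mkord; apply: eq_bigr => i _; congr F; lia.
Qed.

Section BaseMeasure.
Variable R : realType.
Implicit Types (t s q : nat).

(** Central binomial coefficients scaled to 1 at i = 0, a discrete Gaussian. *)
Definition nbin (M i : nat) : R := 'C(2 * M, M + i)%:R / 'C(2 * M, M)%:R.

Definition nbin_weight (M i : nat) : R := (-1) ^+ i * nbin M i *+ 2.

Lemma bin_central_gt0 M : 0 < 'C(2 * M, M)%:R :> R.
Proof. by rewrite ltr0n bin_gt0; lia. Qed.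

Lemma nbin_ge0 M i : 0 <= nbin M i.
Proof. by rewrite /nbin divr_ge0. Qed.

Lemma nbinS M i : (i < M)%N ->
  nbin M i.+1 = nbin M i * ((M - i)%:R / (M + i.+1)%:R).
Proof.
move=> iM; rewrite /nbin -mulrAC; congr (_ / _).
have := mul_bin_left (2 * M) (M + i).
rewrite (_ : 2 * M - (M + i) = M - i)%N; last lia.
move=> /(congr1 (fun k : nat => k%:R : R)); rewrite !natrM addnS => E.
by rewrite mulrA [_ * (M - i)%:R]mulrC -E mulrC mulKf // pnatr_eq0.
Qed.

Lemma nbin0 M : nbin M 0 = 1.
Proof. by rewrite /nbin addn0 divff // gt_eqF // bin_central_gt0. Qed.

(** The ratio of consecutive values is (M - i) / (M + i + 1) <= 1 - (2i + 1) / (2M + 1) <= exp(-(2i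
    + 1) / (2M + 1)), and the odd numbers add up to squares. *)
Lemma nbin_le_expR M i : (i <= M)%N ->
  nbin M i <= expR (- ((i ^ 2)%:R / (2 * M).+1%:R)).
Proof.
elim: i => [|i IH] iM; first by rewrite nbin0 mul0r oppr0 expR0.
rewrite nbinS //.
have -> : - ((i.+1 ^ 2)%:R / (2 * M).+1%:R) =
    - ((i ^ 2)%:R / (2 * M).+1%:R) + - ((2 * i).+1%:R / (2 * M).+1%:R) :> R.
  by rewrite -opprD -mulrDl -natrD; congr (- (_%:R / _)); lia.
rewrite expRD; apply: ler_pM; rewrite ?nbin_ge0 ?divr_ge0 ?IH //; first lia.
apply: le_trans (expR_ge1Dx _).
rewrite -subr_ge0.
have -> : 1 - (2 * i).+1%:R / (2 * M).+1%:R - (M - i)%:R / (M + i.+1)%:R =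
   (2 * i).+1%:R * ((M + i.+1)%:R^-1 - (2 * M).+1%:R^-1) :> R.
  rewrite natrB; last lia.
  have E x : (2 * x).+1%:R = 2 * x%:R + 1 :> R by rewrite -natr1 natrM.
  rewrite !E natrD -natr1.
  have i0 : 0 <= i%:R :> R by []. have M0 : 0 <= M%:R :> R by [].
  field; rewrite !gt_eqF //; lra.
rewrite mulr_ge0 // subr_ge0 lef_pV2 ?posrE ?ltr0n //; last lia.
by rewrite ler_nat; lia.
Qed.

(** The difference of order 2M kills the even power (l - M)^(2j) since 2j < 2M; folding the sum
    about l = M produces the factor 2 of [nbin_weight]. *)
Lemma nbin_weight_orth M j : (j < M)%N ->
  (j == 0%N)%:R + \sum_(i < M) nbin_weight M i.+1 * (i.+1 ^ 2)%:R ^+ j = 0 :> R.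
Proof.
move=> jM.
pose F (l : nat) : R :=
  (-1) ^+ l * 'C(2 * M, l)%:R * (l%:R + (- M%:R)) ^+ (2 * j).
have S0 : \sum_(l < (2 * M).+1) F l = 0 by apply: sum_alt_bin_pow; lia.
have sF i : (i <= M)%N -> F (M - i)%N = F (M + i)%N.
  move=> iM; rewrite /F; congr (_ * _ * _).
  - by rewrite -signr_odd oddB // -oddD signr_odd.
  - by rewrite -bin_sub; [congr (_%:R); congr ('C(_, _)); lia|lia].
  - by rewrite !exprM natrB // natrD; congr (_ ^+ _); ring.
rewrite sum_symmetric_ord // in S0.
have C0 : 'C(2 * M, M)%:R != 0 :> R by rewrite gt_eqF // bin_central_gt0.
apply: (mulfI (_ : (-1) ^+ M * 'C(2 * M, M)%:R != 0)).
  by rewrite mulf_neq0 // signr_eq0.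
rewrite mulr0 -[RHS]S0 mulrDr mulr_sumr; congr (_ + _).
  rewrite /F subrr; case: j {jM S0 sF F} => [|j]; first by rewrite muln0 expr0.
  by rewrite expr0n muln_eq0 /= !mulr0.
apply: eq_bigr => i _; rewrite /F /nbin_weight /nbin natrD addrAC subrr add0r.
rewrite exprM natrX exprD.
by field.
Qed.

Lemma sum_ord_delta (r c : nat) (g : nat -> R) : (c <= r)%N ->
  \sum_(t < r.+1) (t == c :> nat)%:R * g t = g c.
Proof.
move=> cr; rewrite (bigD1 (inord c)) //= inordK ?ltnS // eqxx mul1r big1 ?addr0 //.
move=> i ic; case: eqP => [ec|_]; last by rewrite mul0r.
by move: ic; rewrite -ec inord_val eqxx.
Qed.

Lemma sum_inv_sq_tail (r : nat) (tau : R) : 0 < tau ->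
  \sum_(t < r.+1) ((0 < t)%N && (tau <= t%:R))%:R / t%:R ^+ 2 <= 2 / tau.
Proof.
move=> tau0.
pose f k : R := \sum_(t < k.+1) ((0 < t)%N && (tau <= t%:R))%:R / t%:R ^+ 2.
rewrite -/(f r).
(* Once r has reached tau the induction carries the sharper bound 2 / tau - 1 / r, which telescopes
   because 1 / (r + 1)^2 <= 1 / r - 1 / (r + 1). *)
have [H1 H2] : ((r == 0)%N || (r%:R < tau) -> f r = 0) /\
    ((0 < r)%N && (tau <= r%:R) -> f r <= 2 / tau - r%:R^-1).
  elim: r => [|r [IH0 IH1]].
    by split=> // _; rewrite /f big_ord_recl big_ord0 /= mul0r addr0.
  have r0 : 0 < r.+1%:R :> R by [].
  split=> /= [lt|le]; rewrite /f big_ord_recr /= -/(f r).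
    rewrite (ltNge r.+1%:R) in lt; rewrite (negbTE lt) mul0r addr0 IH0 //.
    rewrite -ltNge in lt; apply/orP; right; apply: le_lt_trans lt.
    by rewrite ler_nat.
  rewrite le mul1r.
  case: (boolP ((r == 0)%N || (r%:R < tau))) => c.
    rewrite IH0 // add0r lerBrDr.
    apply: (@le_trans _ _ (2 / r.+1%:R)); last first.
      by rewrite ler_pM2l // lef_pV2 ?posrE.
    rewrite (_ : 2 = 1 + 1) // mulrDl mul1r lerD2r -exprVn expr2.
    by rewrite ger_pMl ?invr_gt0 // invf_le1 // ler1n.
  rewrite negb_or -leNgt -lt0n in c; apply: le_trans (lerD (IH1 c) (lexx _)) _.
  case/andP: c => rgt0 _.
  rewrite -addrA lerD2l -subr_ge0.
  have r1 : 0 < r%:R :> R by rewrite ltr0n.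
  have -> : - r.+1%:R^-1 - (- r%:R^-1 + (r.+1%:R ^+ 2)^-1) =
     (r%:R * r.+1%:R ^+ 2)^-1 :> R.
    by rewrite -natr1; field; rewrite !gt_eqF //; lra.
  by rewrite invr_ge0 mulr_ge0 // ?exprn_ge0 // ltW.
have t2 : 0 <= 2 / tau by rewrite divr_ge0 // ltW.
case: (boolP ((0 < r)%N && (tau <= r%:R))) => c.
  by apply: le_trans (H2 c) _; rewrite gerBl invr_ge0.
by rewrite H1 //; move: c; rewrite negb_and -leqNgt leqn0 -ltNge.
Qed.

(* Dividing an orthogonal weight by t - q and balancing the result at the node *)
(* q gains one degree of orthogonality, because (t^e - q^e) / (t - q) is a     *)
(* polynomial of degree e - 1.                                                 *)
Definition addnode (r q : nat) (w : nat -> R) (t : nat) : R :=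
  if t == q then - \sum_(s < r.+1) w s / (s%:R - q%:R)
  else w t / (t%:R - q%:R).

Lemma addnode_orth (r q E : nat) (w : nat -> R) : (q <= r)%N -> w q = 0 ->
  (forall e, (e < E)%N -> \sum_(t < r.+1) w t * t%:R ^+ e = 0) ->
  forall e, (e < E.+1)%N -> \sum_(t < r.+1) addnode r q w t * t%:R ^+ e = 0.
Proof.
move=> qr wq0 worth e eE.
have split_node (t : nat) : addnode r q w t * t%:R ^+ e =
    w t / (t%:R - q%:R) * t%:R ^+ e -
    (t == q)%:R * ((\sum_(s < r.+1) w s / (s%:R - q%:R)) * t%:R ^+ e).
  rewrite /addnode; case: eqP => [->|_]; last by rewrite mul0r subr0.
  by rewrite wq0 !mul0r sub0r mul1r mulNr.
under eq_bigr do rewrite split_node.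
rewrite sumrB (sum_ord_delta (fun t => _ * t%:R ^+ e)) // mulr_suml -sumrB.
transitivity (\sum_(t < r.+1) \sum_(i < e)
   q%:R ^+ i * (w t * t%:R ^+ (e.-1 - i))).
  apply: eq_bigr => t _; rewrite -mulrBr subrXX.
  case: (eqVneq (t : nat) q) => [->|tq].
    by rewrite wq0 !mul0r big1 // => i _; rewrite mul0r mulr0.
  rewrite -mulrA mulKf; last by rewrite subr_eq0 eqr_nat.
  by rewrite mulr_sumr; apply: eq_bigr => i _; ring.
rewrite exchange_big big1 // => i _.
rewrite -mulr_sumr worth ?mulr0 //; have := ltn_ord i; lia.
Qed.

(** The nodes i^2 are stretched to K i^2, leaving an empty gap between 0 and K into which the nodes
    1 and Q are inserted later. *)
Definition omega0 (K M t : nat) : R :=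
  (t == 0)%N%:R + \sum_(i < M) nbin_weight M i.+1 * (t == K * i.+1 ^ 2)%N%:R.

Lemma omega0_orth K M r e : (K * M ^ 2 <= r)%N -> (e < M)%N ->
  \sum_(t < r.+1) omega0 K M t * t%:R ^+ e = 0.
Proof.
move=> Kr eM; rewrite /omega0.
under eq_bigr do rewrite mulrDl mulr_suml.
rewrite big_split /= (sum_ord_delta (fun t => t%:R ^+ e)) // exchange_big /=.
transitivity (K%:R ^+ e * ((e == 0%N)%:R +
    \sum_(i < M) nbin_weight M i.+1 * (i.+1 ^ 2)%:R ^+ e)); last first.
  by rewrite nbin_weight_orth ?mulr0.
rewrite mulrDr; congr (_ + _).
  by case: e {eM} => [|e]; rewrite ?expr0 ?mulr1 // expr0n mulr0.
rewrite mulr_sumr; apply: eq_bigr => i _.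
under eq_bigr do rewrite -mulrA.
rewrite -mulr_sumr (sum_ord_delta (fun t => t%:R ^+ e)).
  by rewrite natrM exprMn; ring.
by apply: leq_trans Kr; rewrite leq_mul2l leq_sqr ltn_ord orbT.
Qed.

Lemma nbin_le1 M i : (i <= M)%N -> nbin M i <= 1.
Proof.
move=> iM; apply: le_trans (nbin_le_expR iM) _.
by rewrite -expR0 ler_expR oppr_le0 divr_ge0.
Qed.

Lemma omega0_at0 K M : (0 < K)%N -> omega0 K M 0 = 1.
Proof.
move=> K0; rewrite /omega0 eqxx big1 ?addr0 // => i _.
case: eqP => [|_]; [lia|exact: mulr0].
Qed.

Lemma omega0_atom K M t : (0 < K)%N -> (0 < t)%N -> omega0 K M t != 0 ->
  exists i, [/\ (0 < i <= M)%N, t = (K * i ^ 2)%N &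
    omega0 K M t = nbin_weight M i].
Proof.
move=> K0 t0; rewrite /omega0 (gtn_eqF t0) add0r => nz.
case: (pickP (fun i : 'I_M => t == K * i.+1 ^ 2)%N) => [i /eqP ti|none]; last first.
  by move: nz; rewrite big1 ?eqxx // => i _; rewrite none mulr0.
exists i.+1; split=> //; first exact: ltn_ord.
rewrite (bigD1 i) //= -ti eqxx mulr1 big1 ?addr0 // => j ji.
rewrite ti eqn_pmul2l // eqn_sqr eqSS (_ : (i == j :> nat) = false) ?mulr0 //.
by apply/negbTE; rewrite eq_sym.
Qed.

Lemma omega0_ge K M t : (0 < K)%N -> (0 < t)%N -> omega0 K M t != 0 -> (K <= t)%N.
Proof.
move=> K0 t0 /omega0_atom[//|//|i [/andP[i0 _] -> _]].
by rewrite leq_pmulr // expn_gt0 i0.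
Qed.

Lemma normr_nbin_weight M i : `|nbin_weight M i| = 2 * nbin M i.
Proof.
rewrite /nbin_weight normrMn normrM normr_sign mul1r ger0_norm ?nbin_ge0 //.
by rewrite mulr_natl.
Qed.

Lemma omega0_bound K M t : (0 < K)%N -> (0 < t)%N ->
  `|omega0 K M t| <= 2 * expR (- (t%:R / (K * (2 * M).+1)%:R)).
Proof.
move=> K0 t0; have [->|nz] := eqVneq (omega0 K M t) 0.
  by rewrite normr0 mulr_ge0 // expR_ge0.
have [i [/andP[i0 iM] -> ->]] := omega0_atom K0 t0 nz.
rewrite normr_nbin_weight ler_pM2l //; apply: le_trans (nbin_le_expR iM) _.
rewrite (_ : (K * i ^ 2)%:R / _ = (i ^ 2)%:R / (2 * M).+1%:R :> R) //.
by rewrite !natrM -mulf_div divff ?mul1r // pnatr_eq0 -lt0n.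
Qed.

(** The atom at K i^2 has absolute mass at most 2, and the inverse squares add up to at most 2. *)
Lemma omega0_mass K M r : (0 < K)%N ->
  \sum_(t < r.+1) `|omega0 K M t| / t%:R <= 4 / K%:R.
Proof.
move=> K0; have K0' : 0 < K%:R :> R by rewrite ltr0n.
apply: (@le_trans _ _ (\sum_(t < r.+1) \sum_(i < M)
    2 / K%:R / i.+1%:R ^+ 2 * (t == K * i.+1 ^ 2 :> nat)%N%:R)).
  apply: ler_sum => -[[|t] tr] _ /=.
    rewrite invr0 mulr0; apply: sumr_ge0 => i _.
    by rewrite mulr_ge0 // !divr_ge0 ?exprn_ge0.
  rewrite /omega0 add0r.
  apply: (@le_trans _ _ ((\sum_(i < M) 2 * (t.+1 == K * i.+1 ^ 2)%N%:R) / t.+1%:R)).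
    rewrite ler_pM2r ?invr_gt0 //; apply: le_trans (ler_norm_sum _ _ _) _.
    apply: ler_sum => i _; rewrite normrM normr_nat ler_wpM2r //.
    by rewrite normr_nbin_weight ler_piMr // nbin_le1.
  rewrite mulr_suml; apply: ler_sum => i _.
  case: eqP => [->|_]; last by rewrite !mulr0 mul0r.
  rewrite !mulr1 natrM natrX le_eqVlt; apply/orP; left; apply/eqP.
  by rewrite invfM mulrA.
rewrite exchange_big /=.
apply: (@le_trans _ _ (\sum_(i < M) 2 / K%:R / i.+1%:R ^+ 2)).
  apply: ler_sum => i _; rewrite -mulr_sumr ler_piMr ?divr_ge0 ?exprn_ge0 //.
  have [le|lt] := leqP (K * i.+1 ^ 2) r.
    under eq_bigr do rewrite -[_%:R]mulr1.
    by rewrite (sum_ord_delta (fun=> 1)).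
  rewrite big1 // => -[t tr] _ /=; case: eqP => // tE.
  by move: tr lt; rewrite tE; lia.
rewrite -mulr_sumr (_ : 4 / K%:R = 2 / K%:R * 2); last by ring.
rewrite ler_wpM2l ?divr_ge0 //.
have := sum_inv_sq_tail M (ltr01 : 0 < 1 :> R).
rewrite big_ord_recl /= mul0r add0r divr1; apply: le_trans.
by apply: ler_sum => i _; rewrite /bump leq0n add1n ler1n /= mul1r.
Qed.

End BaseMeasure.

Lemma big_ord_recl2 (V : nmodType) (r : nat) (F : nat -> V) :
  \sum_(s < r.+2) F s = F 0%N + F 1%N + \sum_(s < r) F s.+2.
Proof.
by rewrite 2!big_ord_recl /= addrA; congr (_ + _).
Qed.

(** * Inserting the nodes 1 and Q: quadratic decay and concentration at 1 *)

Section ThreeNodes.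
Variables (R : realType) (K Q M r : nat).
Hypotheses (Q1 : (1 < Q)%N) (QK : (2 * Q <= K)%N) (M0 : (0 < M)%N).
Hypothesis KMr : (K * M ^ 2 <= r.+1)%N.

Let w : nat -> R := omega0 R K M.
Let w1 := addnode r.+1 1 w.

(** Away from 1 and Q this is Q omega0(t) / ((t - 1) (t - Q)); the factor Q makes the mass at 0
    equal to 1. *)
Definition omega (t : nat) : R := Q%:R * addnode r.+1 Q w1 t.

Let sig := \sum_(t < r) `|w t.+2| / t.+2%:R.

Let K0 : (0 < K)%N. Proof. lia. Qed.

Let Kr : (K <= r.+1)%N.
Proof. by apply: leq_trans KMr; rewrite leq_pmulr // expn_gt0 M0. Qed.

Let w_small t : (0 < t < K)%N -> w t = 0.
Proof.
move=> /andP[t0 tK]; apply/eqP; apply: contraTT tK => nz.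
by rewrite -leqNgt (omega0_ge K0 t0 nz).
Qed.

Let w0E : w 0 = 1. Proof. exact: omega0_at0. Qed.

Let sig_le : sig <= 4 / K%:R.
Proof.
have := omega0_mass R M r.+1 K0; rewrite (big_ord_recl2 _ (fun t => `|omega0 R K M t| / t%:R)).
by apply: le_trans; rewrite lerDr addr_ge0 // mulr_ge0.
Qed.

Let Q1' : (1 : R) < Q%:R. Proof. by rewrite ltr1n. Qed.

Lemma omega_orth e : (e <= M)%N -> \sum_(t < r.+2) omega t * t%:R ^+ e = 0.
Proof.
move=> eM; rewrite /omega.
under eq_bigr do rewrite -mulrA.
rewrite -mulr_sumr.
have w1Q : w1 Q = 0.
  by rewrite /w1 /addnode gtn_eqF // w_small ?mul0r //; lia.
have orth1 j : (j < M.+1)%N -> \sum_(t < r.+2) w1 t * t%:R ^+ j = 0.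
  apply: addnode_orth => //; first by rewrite w_small //; lia.
  by move=> i iM; apply: omega0_orth.
rewrite (addnode_orth (E := M.+1)) ?mulr0 //; last exact: leqW.
by apply: leq_trans Kr; lia.
Qed.

Let w1_0 : w1 0 = -1.
Proof. by rewrite /w1 /addnode /= w0E sub0r mul1r invrN1. Qed.

Let w1_1 : `|w1 1 - 1| <= 2 * sig.
Proof.
rewrite /w1 /addnode eqxx (big_ord_recl2 _ (fun s => w s / (s%:R - 1%:R))).
rewrite w0E sub0r mul1r invrN1 subrr invr0 mulr0 addr0 opprD opprK.
rewrite addrAC subrr add0r normrN; apply: le_trans (ler_norm_sum _ _ _) _.
rewrite mulr_sumr; apply: ler_sum => i _; rewrite normrM normfV.
rewrite mulrCA ler_wpM2l // (_ : i.+2%:R - 1%:R = i.+1%:R); last first.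
  by rewrite -natrB // subn1.
rewrite normr_nat -[X in X * _]invrK -invfM lef_pV2 ?posrE //.
by rewrite mulrC ler_pdivrMr // -natrM ler_nat; lia.
Qed.

Let w1_2 t : (1 < t)%N -> w1 t = w t / (t%:R - 1).
Proof. by move=> t1; rewrite /w1 /addnode gtn_eqF. Qed.

Lemma omega_at0 : omega 0 = 1.
Proof.
rewrite /omega /addnode ltn_eqF; last lia.
rewrite w1_0 sub0r invrN mulrNN mul1r divff // gt_eqF //; (move: Q1'; lra).
Qed.

(** If [omega0] were only the unit mass at 0, balancing would give [w1 1] = 1 and so mass -Q / (Q -
    1) here; the atoms beyond the gap move [w1 1] by at most 2 [sig]. *)
Lemma omega_at1 :
  `|omega 1 + Q%:R / (Q%:R - 1)| <= Q%:R / (Q%:R - 1) * (8 / K%:R).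
Proof.
rewrite /omega /addnode ltn_eqF // (_ : _ + _ = - (Q%:R / (Q%:R - 1) * (w1 1 - 1))).
  have Q0 : 0 < Q%:R / (Q%:R - 1) :> R by rewrite divr_gt0 //; (move: Q1'; lra).
  rewrite normrN normrM gtr0_norm // ler_pM2l //; apply: le_trans w1_1 _.
  by move: sig_le; lra.
rewrite (_ : 1%:R - Q%:R = - (Q%:R - 1)); last by ring.
rewrite invrN; ring.
Qed.

Let half_le (t q : nat) : (2 * q <= t)%N -> (0 < t)%N ->
  (t%:R - q%:R)^-1 <= 2 / t%:R :> R /\ 0 < t%:R - q%:R :> R.
Proof.
move=> qt t0; have t0' : 0 < t%:R :> R by rewrite ltr0n.
have qt' : 2 * q%:R <= t%:R :> R by rewrite -natrM ler_nat.
have d0 : 0 < t%:R - q%:R :> R by (move: Q1'; lra).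
by split=> //; rewrite ler_pdivlMr // mulrC ler_pdivrMr //; (move: Q1'; lra).
Qed.

Lemma omega_far t : (1 < t)%N -> t != Q ->
  `|omega t| <= 4 * Q%:R * `|w t| / t%:R ^+ 2.
Proof.
move=> t1 tQ; rewrite /omega /addnode (negbTE tQ) w1_2 //.
have [->|nz] := eqVneq (w t) 0.
  by rewrite !mul0r mulr0 normr0 mulr0 mul0r.
have t0 : (0 < t)%N by lia.
have Kt : (K <= t)%N by exact: (omega0_ge K0 t0 nz).
have [h1 p1] : (t%:R - 1)^-1 <= 2 / t%:R :> R /\ 0 < t%:R - 1 :> R.
  by apply: (@half_le t 1); lia.
have [hQ pQ] := @half_le t Q (ltac:(lia)) t0.
rewrite !normrM !normfV (gtr0_norm p1) (gtr0_norm pQ) normr_nat.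
have -> : 4 * Q%:R * `|w t| / t%:R ^+ 2 =
   Q%:R * (`|w t| * (2 / t%:R) * (2 / t%:R)) :> R.
  by field; rewrite pnatr_eq0 -lt0n.
rewrite ler_wpM2l //; apply: ler_pM => //; rewrite ?mulr_ge0 ?invr_ge0 ?(ltW p1) ?(ltW pQ) //.
by rewrite ler_wpM2l.
Qed.

Let omega_mass_far :
  \sum_(t < r | (t.+2 != Q)%N) `|omega t.+2| <= 4 * sig.
Proof.
rewrite mulr_sumr; apply: (@le_trans _ _
  (\sum_(t < r | (t.+2 != Q)%N) 4 * (`|w t.+2| / t.+2%:R))); last first.
  by rewrite big_mkcond; apply: ler_sum => t _; case: ifP => // _;
    rewrite mulr_ge0 // divr_ge0.
apply: ler_sum => t tQ; apply: le_trans (omega_far _ tQ) _ => //.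
have [->|nz] := eqVneq (w t.+2) 0; first by rewrite normr0 !(mulr0, mul0r).
have Kt : (K <= t.+2)%N by exact: (omega0_ge K0 _ nz).
have -> : 4 * Q%:R * `|w t.+2| / t.+2%:R ^+ 2 =
   4 * (`|w t.+2| / t.+2%:R) * (Q%:R / t.+2%:R) :> R.
  by field; rewrite gt_eqF // ltr0n.
rewrite ler_piMr ?mulr_ge0 ?divr_ge0 // ler_pdivrMr // mul1r ler_nat; lia.
Qed.

(** The contributions of the nodes 0 and 1 nearly cancel, -1 + Q / (Q - 1) = 1 / (Q - 1), so a large
    Q leaves little mass at Q. *)
Let omega_atQ' : `|omega Q| <= (Q%:R - 1)^-1 + 8 * sig.
Proof.
rewrite /omega /addnode eqxx (big_ord_recl2 _ (fun s => w1 s / (s%:R - Q%:R))).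
rewrite w1_0 sub0r.
set S := (\sum_(s < r) _).
have SE : `|Q%:R * S| <= 4 * sig.
  rewrite /S mulr_sumr mulr_sumr; apply: le_trans (ler_norm_sum _ _ _) _.
  apply: ler_sum => t _; rewrite w1_2 //.
  have [->|nz] := eqVneq (w t.+2) 0; first by rewrite !(mulr0, mul0r, normr0).
  have Kt : (K <= t.+2)%N by exact: (omega0_ge K0 _ nz).
  have [h1 p1] : (t.+2%:R - 1)^-1 <= 2 / t.+2%:R :> R /\ 0 < t.+2%:R - 1 :> R.
    by apply: (@half_le t.+2 1); lia.
  have [hQ pQ] := @half_le t.+2 Q (ltac:(lia)) isT.
  rewrite !normrM !normfV (gtr0_norm p1) (gtr0_norm pQ) normr_nat.
  apply: (@le_trans _ _ (Q%:R * (`|w t.+2| * (2 / t.+2%:R) * (2 / t.+2%:R)))).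
    rewrite ler_wpM2l //; apply: ler_pM => //; rewrite ?mulr_ge0 ?invr_ge0 ?(ltW p1) ?(ltW pQ) //.
    by rewrite ler_wpM2l.
  rewrite (_ : Q%:R * _ = 4 * (`|w t.+2| / t.+2%:R) * (Q%:R / t.+2%:R)); last first.
    by field; rewrite gt_eqF // ltr0n.
  by rewrite ler_piMr ?mulr_ge0 ?divr_ge0 // ler_pdivrMr // mul1r ler_nat; lia.
have -> : Q%:R * - (-1 / - Q%:R + w1 1 / (1 - Q%:R) + S) =
    (Q%:R - 1)^-1 + Q%:R / (Q%:R - 1) * (w1 1 - 1) - Q%:R * S.
  by field; move: Q1' => q1; apply/and3P; split;
    [rewrite gt_eqF|rewrite lt_eqF|rewrite gt_eqF] => //; lra.
apply: le_trans (ler_normB _ _) _; apply: le_trans (lerD (ler_normD _ _) SE) _.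
rewrite gtr0_norm ?invr_gt0; last (move: Q1'; lra).
rewrite -addrA lerD2l (_ : 8 * sig = 2 * (2 * sig) + 4 * sig); last by ring.
rewrite lerD2r normrM ler_pM // gtr0_norm; last by rewrite divr_gt0; (move: Q1'; lra).
have : 2 <= Q%:R :> R by rewrite ler_nat.
by move=> ?; rewrite ler_pdivrMr; (move: Q1'; lra).
Qed.

Lemma omega_atQ : `|omega Q| <= (Q%:R - 1)^-1 + 32 / K%:R.
Proof. by apply: le_trans omega_atQ' _; move: sig_le; lra. Qed.

Lemma omega_mass :
  \sum_(t < r.+2 | (1 < t)%N) `|omega t| <= (Q%:R - 1)^-1 + 48 / K%:R.
Proof.
rewrite big_mkcond (big_ord_recl2 _ (fun t => if (1 < t)%N then `|omega t| else 0)).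
rewrite /= !add0r (bigID (fun t : 'I_r => t.+2 == Q)) /=.
have Qr : (Q - 2 < r)%N by move: Kr; lia.
rewrite (big_pred1 (Ordinal Qr)) /=; last first.
  move=> t; apply/eqP/eqP => [e|->]; last by rewrite /=; lia.
  by apply: val_inj => /=; lia.
rewrite (_ : (Q - 2).+2 = Q); last lia.
have := lerD omega_atQ' omega_mass_far; move: sig_le.
by move=> *; lra.
Qed.

End ThreeNodes.

Definition decay (R : realType) (m t : nat) : R :=
  expR (- (t%:R / (3 * (128 * m))%:R)).

(** * The two measures A and B on the line *)

Section BasePair.
Variable R : realType.

Lemma expR_half_le2 (x : R) : x <= 1 / 2 -> expR x <= 2.
Proof.
move=> x2; rewrite -[x]opprK expRN invf_ple ?posrE ?expR_gt0 //.
by apply: le_trans (expR_ge1Dx _); lra.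
Qed.

Lemma decay_ge (m t : nat) : (2 * t <= 3 * (128 * m))%N -> 1 / 2 <= decay R m t.
Proof.
case: m => [|m] tm.
  rewrite /decay !muln0 invr0 mulr0 oppr0 expR0; lra.
rewrite /decay; set y := t%:R / _; apply: le_trans (expR_ge1Dx _).
suff : y <= 1 / 2 by lra.
rewrite ler_pdivrMr ?ltr0n //.
have : ((2 * t)%:R : R) <= (3 * (128 * m.+1))%:R by rewrite ler_nat.
by rewrite natrM; lra.
Qed.

(** With M = m / 128 and K = 128^2 the last node K M^2 is at most m^2, and the decay scale K (2M +
    1) is at most 384 m. The choice Q = 256 makes 1 / 255 + 48 / K at most 1 / 128. *)
Lemma omega_exists (m : nat) : (0 < m)%N -> exists w : nat -> R,
  [/\ forall e, (e <= m %/ 128)%N -> \sum_(t < (m ^ 2).+1) w t * t%:R ^+ e = 0,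
      w 0 = 1, - 3 <= w 1 <= - (1 / 2),
      \sum_(t < (m ^ 2).+1 | (1 < t)%N) `|w t| <= 1 / 128 &
      forall t, (0 < t)%N -> `|w t| <= 2 * 256 * 256 / t%:R ^+ 2 * decay R m t].
Proof.
move=> m0; have g0 t : 0 <= decay R m t by exact: expR_ge0.
have [M0|] := posnP (m %/ 128).
  (* For m < 128 only constants have to be annihilated, and delta_0 - delta_1 does so. *)
  exists (fun t => (t == 0)%N%:R - (t == 1)%N%:R); split=> //=.
  - move=> e; rewrite M0 leqn0 => /eqP ->.
    under eq_bigr do rewrite mulrBl.
    rewrite sumrB (sum_ord_delta (fun=> 1 : R)) //.
    by rewrite (sum_ord_delta (fun=> 1 : R)) ?subrr // expn_gt0 m0.
  - by rewrite subr0.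
  - by rewrite sub0r; lra.
  - by rewrite big1 // => -[[|[|t]] tm] //= _; rewrite subrr normr0.
  - move=> [|[|t]] // _ /=; last by rewrite subrr normr0 mulr_ge0.
    have : 1 / 2 <= decay R m 1 by apply: decay_ge; lia.
    by rewrite sub0r normrN1 expr1n; lra.
move eM : (m %/ 128)%N => M M0.
pose K := (128 * 128)%N; pose Q := 256%N.
have KM : (K * M ^ 2 <= m ^ 2)%N.
  rewrite (_ : K * M ^ 2 = (128 * M) ^ 2)%N; last by rewrite /K; lia.
  by rewrite leq_sqr -eM mulnC leq_divM.
have [r rE] : exists r, (m ^ 2 = r.+1)%N.
  by exists (m ^ 2).-1; rewrite prednK // expn_gt0 m0.
rewrite rE in KM *.
have m128 : (128 * M <= m)%N by rewrite -eM mulnC leq_divM.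
have Q1 : (1 < Q)%N by []. have QK : (2 * Q <= K)%N by rewrite /K /Q; lia.
have QR : Q%:R = 256 :> R by [].
have K0 : (0 < K)%N by [].
have KR : K%:R^-1 = 128^-1 * 128^-1 :> R by rewrite natrM invfM.
have Q1R : (Q%:R - 1)^-1 = 255^-1 :> R by rewrite QR; congr (_^-1); lra.
exists (omega R K Q M r); split.
- exact: omega_orth.
- exact: omega_at0.
- have := omega_at1 R Q1 QK M0 KM; rewrite Q1R QR KR ler_norml => /andP[h1 h2].
  by apply/andP; split; lra.
- by apply: le_trans (omega_mass R Q1 QK M0 KM) _; rewrite Q1R KR; lra.
move=> t t0; have [->|t1] := eqVneq t 1%N.
  have := omega_at1 R Q1 QK M0 KM; rewrite Q1R QR KR => h.
  have -> : omega R K Q M r 1 = omega R K Q M r 1 + 256 / 255 - 256 / 255.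
    by rewrite addrK.
  apply: le_trans (ler_normB _ _) _; apply: le_trans (lerD h (lexx _)) _.
  have : 1 / 2 <= decay R m 1 by apply: decay_ge; lia.
  by rewrite expr1n ger0_norm; lra.
have [->|tQ] := eqVneq t Q.
  apply: le_trans (omega_atQ R Q1 QK M0 KM) _; rewrite Q1R KR.
  have : 1 / 2 <= decay R m Q by apply: decay_ge; rewrite /Q; lia.
  rewrite (_ : 2 * 256 * 256 / Q%:R ^+ 2 = 2); first lra.
  by rewrite QR; field.
apply: le_trans (omega_far R Q1 QK M0 KM _ tQ) _; first lia.
have := omega0_bound R M K0 t0.
have : expR (- (t%:R / (K * (2 * M).+1)%:R)) <= decay R m t.
  rewrite ler_expR lerN2 ler_wpM2l // lef_pV2 ?posrE ?ltr0n ?muln_gt0 ?m0 //.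
  by rewrite ler_nat /K; nia.
move=> h1 h2; rewrite QR.
rewrite [X in _ <= X](_ : _ = 4 * 256 * (2 * 64 * decay R m t) / t%:R ^+ 2); last by ring.
rewrite ler_wpM2r ?invr_ge0 ?exprn_ge0 // ler_wpM2l //.
by move: (g0 t); lra.
Qed.

Lemma sqr_le_expn2 (t : nat) : (t ^ 2 <= 2 * 2 ^ t)%N.
Proof.
elim: t => // t IH; case: (leqP t 2) => [|t3]; first by case: t {IH} => [|[|[|]]].
by rewrite [X in (_ <= _ * X)%N]expnS; apply: (@leq_trans (2 * t ^ 2)); nia.
Qed.

(* A and B share the summand 4^-t / 64, which keeps both of them positive      *)
(* everywhere and so later allows mass to be moved around locally.             *)
Lemma base_pair (m : nat) : (0 < m)%N -> exists A B : nat -> R,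
  [/\ forall e, (e <= m %/ 128)%N ->
        0 ^+ e + \sum_(t < (m ^ 2).+1) A t * t%:R ^+ e =
        \sum_(t < (m ^ 2).+1) B t * t%:R ^+ e,
      A 0 = 0 /\ B 0 = 0,
      forall t, (0 < t)%N -> [/\ 1 / 64 / 4 ^+ t <= A t, 1 / 64 / 4 ^+ t <= B t,
        A t <= 2 * B t,
        A t <= 8 * 256 * 256 / t%:R ^+ 2 * decay R m t &
        B t <= 8 * 256 * 256 / t%:R ^+ 2 * decay R m t],
      \sum_(t < (m ^ 2).+1) A t <= 1 / 32 & 1 / 2 <= B 1].
Proof.
move=> m0; have [w [worth w0 /andP[w1l w1u] wmass wle]] := omega_exists m0.
pose rho (t : nat) : R := 1 / 64 / 4 ^+ t.
have rho0 t : 0 < rho t by rewrite !divr_gt0 // exprn_gt0.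
(* Here A - B = w off 0, and w 0 = 1 supplies delta_0. As w 1 < 0, the big atom at 1 cancels in A
   and remains in B. *)
exists (fun t => if t == 0%N then 0 else `|w t| + w t + rho t).
exists (fun t => if t == 0%N then 0 else `|w t| + rho t).
split=> //.
- move=> e eM; apply/eqP; rewrite -subr_eq0 -addrA -sumrB; apply/eqP.
  rewrite -[RHS](worth e eM) [RHS]big_ord_recl big_ord_recl /= w0 mul1r !mul0r subrr add0r.
  by congr (_ + _); apply: eq_bigr => t _; rewrite -mulrBl; congr (_ * _); ring.
- move=> t t0; rewrite gtn_eqF //.
  have h := wle t t0; have n0 := normr_ge0 (w t); have := rho0 t.
  have := ler_norm (w t); have := lerNnormlW (lexx `|w t|).
  (* 4^-t absorbs both factors, since t^2 <= 2 * 2^t and exp(t / (384 m)) <= 2^t. *)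
  have rg : rho t <= 2 * 256 * 256 / t%:R ^+ 2 * decay R m t.
    have t0' : 0 < t%:R ^+ 2 :> R by rewrite exprn_gt0 // ltr0n.
    rewrite mulrAC ler_pdivlMr // /rho mulrAC ler_pdivrMr ?exprn_gt0 //.
    apply: (@le_trans _ _ (1 / 64 * (2 * 2 ^+ t))).
      by rewrite ler_wpM2l // -!natrX -natrM ler_nat sqr_le_expn2.
    have -> : 4 ^+ t = 2 ^+ t * 2 ^+ t :> R by rewrite -exprMn; congr (_ ^+ _); ring.
    have p0 : 0 < 2 ^+ t :> R by rewrite exprn_gt0.
    rewrite mulrA mulrA ler_pM2r //.
    suff : 1 <= decay R m t * 2 ^+ t by lra.
    rewrite /decay expRN mulrC ler_pdivlMr ?expR_gt0 // mul1r.
    rewrite mulrC expRM_natr; apply: lerXn2r; rewrite ?nnegrE ?expR_ge0 //.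
    apply: expR_half_le2; rewrite ler_pdivlMr // ler_pdivrMl ?ltr0n ?muln_gt0 ?m0 //.
    by rewrite mulr1 ler_nat; lia.
  rewrite -/(rho t).
  have -> : 8 * 256 * 256 / t%:R ^+ 2 * decay R m t =
    4 * (2 * 256 * 256 / t%:R ^+ 2 * decay R m t) by ring.
  by move: h rg; set g := _ * decay R m t => *; split; lra.
- rewrite big_ord_recl /= add0r.
  apply: (@le_trans _ _ (2 * (\sum_(t < (m ^ 2).+1 | (1 < t)%N) `|w t|) +
     \sum_(t < m ^ 2) rho t.+1)); last first.
    suff : \sum_(t < m ^ 2) rho t.+1 <= 1 / 64 by lra.
    apply: (@le_trans _ _ (1 / 64 - rho (m ^ 2)%N)); last by rewrite gerBl ltW.
    elim: (m ^ 2)%N => [|k IH]; first by rewrite big_ord0 /rho expr0; lra.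
    rewrite big_ord_recr /=; apply: le_trans (lerD IH (lexx _)) _.
    have -> : rho k.+1 = rho k / 4 by rewrite /rho exprS invfM; ring.
    by have := rho0 k; lra.
  rewrite big_split /= lerD2r mulr_sumr [X in _ <= X]big_mkcond [X in _ <= X]big_ord_recl /= add0r.
  apply: ler_sum => -[[|i] im] _ /=; first by rewrite ler0_norm ?addNr; lra.
  by rewrite /bump /= add1n mulr_natl mulr2n lerD2l ler_norm.
- by rewrite /= ler0_norm; [have := rho0 1%N; lra | lra].
Qed.

End BasePair.

(** * The pair of distributions for one block *)

(* Mass can be moved from y to x, which differ only on S and have the same     *)
(* zeros, at the price of the factor prod_S hi(y_i) / lo(x_i).                 *)
Definition movable (R : realType) (I : finType) (r : nat) (lo hi : nat -> R)
    (L : {ffun I -> 'I_r.+1} -> R) : Prop :=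
  forall (S : {set I}) (x y : {ffun I -> 'I_r.+1}),
    (forall i, i \notin S -> x i = y i) ->
    (forall i, i \in S -> (0 < x i)%N /\ (0 < y i)%N) ->
    L y * \prod_(i in S) lo (x i) <= L x * \prod_(i in S) hi (y i).

Lemma movable_prod (R : realType) (I : finType) (r : nat) (lo hi F : nat -> R) :
  (forall t, 0 <= F t) -> (forall t, (0 < t)%N -> 0 <= lo t <= F t) ->
  (forall t, (0 < t)%N -> F t <= hi t) ->
  movable lo hi (fun y : {ffun I -> 'I_r.+1} => \prod_i F (y i)).
Proof.
move=> F0 loF Fhi S x y xy pos.
rewrite [\prod_(i in S) lo _]big_mkcond [\prod_(i in S) hi _]big_mkcond.
rewrite -!big_split /=; apply: ler_prod => i _; case: ifP => iS.
  have [x0 y0] := pos i iS; have /andP[lo0 loF'] := loF _ x0.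
  by rewrite mulr_ge0 //= [X in _ <= X]mulrC ler_pM // Fhi.
by rewrite !mulr1 F0 xy ?iS /=.
Qed.

Section BlockDual.
Variables (R : realType) (m : nat) (A B : nat -> R).
Notation r := (m ^ 2)%N.
Notation d := (m %/ 128)%N.
Notation point := {ffun 'I_m -> 'I_(m ^ 2).+1}.

Definition base_lo (t : nat) : R := 1 / 64 / 4 ^+ t.
Definition base_hi (t : nat) : R := 8 * 256 * 256 / t%:R ^+ 2 * decay R m t.

Hypothesis m0 : (0 < m)%N.
Hypothesis momAB : forall e, (e <= d)%N ->
  0 ^+ e + \sum_(t < r.+1) A t * t%:R ^+ e = \sum_(t < r.+1) B t * t%:R ^+ e.
Hypothesis AB0 : A 0 = 0 /\ B 0 = 0.
Hypothesis ABle : forall t, (0 < t)%N ->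
  [/\ base_lo t <= A t, base_lo t <= B t, A t <= 2 * B t,
      A t <= base_hi t & B t <= base_hi t].
Hypothesis massA : \sum_(t < r.+1) A t <= 1 / 32.
Hypothesis B1 : 1 / 2 <= B 1.

Let a := \sum_(t < r.+1) A t.

Lemma base_lo_gt0 t : 0 < base_lo t.
Proof. by rewrite !divr_gt0 // exprn_gt0. Qed.

Let A_ge0 t : 0 <= A t.
Proof.
case: t => [|t]; first by rewrite AB0.1.
by have [h _ _ _ _] := ABle (ltn0Sn t); apply: le_trans h; rewrite ltW ?base_lo_gt0.
Qed.

Let B_ge0 t : 0 <= B t.
Proof.
case: t => [|t]; first by rewrite AB0.2.
by have [_ h _ _ _] := ABle (ltn0Sn t); apply: le_trans h; rewrite ltW ?base_lo_gt0.
Qed.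

Let a_ge0 : 0 <= a. Proof. exact: sumr_ge0. Qed.

Let r0 : (0 < r)%N. Proof. by rewrite expn_gt0 m0. Qed.

Let A1_le_a : A 1 <= a.
Proof.
rewrite /a (bigD1 (inord 1)) //= inordK ?ltnS // lerDl.
by apply: sumr_ge0.
Qed.

Let P1 (S : {set 'I_m}) (y : point) : R :=
  \prod_i (if i \in S then A (y i) - a * (y i == 1%N :> nat)%:R
           else a * (y i == 1%N :> nat)%:R).

(* Every factor A - a delta_1 annihilates constants, so the terms of A^(x)m =  *)
(* ((A - a delta_1) + a delta_1)^(x)m with more than d such factors may be     *)
(* dropped.                                                                    *)
Definition kappa (y : point) : R := \sum_(S : {set 'I_m} | (#|S| <= d)%N) P1 S y.

(** Subtracting the product of the A leaves exactly the points with a zero coordinate in L_0. In L_1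
    that product need not lie below the product of the B, so [kappa], with the same low moments, is
    subtracted instead. *)
Definition block_measure (b : bool) (y : point) : R :=
  if b then \prod_i B (y i) - kappa y
  else \prod_i ((y i == 0%N :> nat)%:R + A (y i)) - \prod_i A (y i).

Lemma kappa_moment (e : 'I_m -> nat) : (\sum_i e i <= d)%N ->
  \sum_(y : point) kappa y * \prod_i (y i)%:R ^+ e i =
  \sum_(y : point) (\prod_i A (y i)) * \prod_i (y i)%:R ^+ e i.
Proof.
move=> ed.
transitivity (\sum_(S : {set 'I_m}) \sum_(y : point) P1 S y * \prod_i (y i)%:R ^+ e i).
  under eq_bigr do rewrite mulr_suml.
  rewrite exchange_big /= [RHS](bigID (fun S : {set 'I_m} => (#|S| <= d)%N)) /=.
  rewrite [X in _ = _ + X]big1 ?addr0 // => S; rewrite -ltnNge => dS.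
  have [i iS ei] : exists2 i, i \in S & e i = 0%N.
    case: (pickP (fun i => (i \in S) && (e i == 0%N))) => [i /andP[iS /eqP ei]|none].
      by exists i.
    suff h : (#|S| <= \sum_i e i)%N by move: dS; rewrite ltnNge (leq_trans h ed).
    rewrite -sum1_card big_mkcond; apply: leq_sum => i _; case: ifP => // iS.
    by have := none i; rewrite iS /= lt0n => ->.
  rewrite /P1; under eq_bigr do rewrite -big_split /=.
  rewrite -(bigA_distr_bigA (fun i (t : 'I_r.+1) => (if i \in S then
     A t - a * (t == 1%N :> nat)%:R else a * (t == 1%N :> nat)%:R) * t%:R ^+ e i)).
  rewrite (bigD1 i) //= iS ei.
  under eq_bigr do rewrite expr0 mulr1 [a * _]mulrC.
  by rewrite sumrB (sum_ord_delta (fun=> a)) // subrr mul0r.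
rewrite exchange_big /=; apply: eq_bigr => y _; rewrite -mulr_suml; congr (_ * _).
rewrite /P1 -(@bigA_distr R 0 1 _ _ _ (fun i => A (y i) - a * (y i == 1%N :> nat)%:R)
  (fun i => a * (y i == 1%N :> nat)%:R)).
by apply: eq_bigr => i _; rewrite /= subrK.
Qed.

Lemma block_moment (e : 'I_m -> nat) : (\sum_i e i <= d)%N ->
  \sum_(y : point) block_measure true y * \prod_i (y i)%:R ^+ e i =
  \sum_(y : point) block_measure false y * \prod_i (y i)%:R ^+ e i.
Proof.
move=> ed; rewrite /block_measure.
under eq_bigr do rewrite mulrBl.
under [RHS]eq_bigr do rewrite mulrBl.
rewrite !sumrB kappa_moment //; congr (_ - _).
under eq_bigr do rewrite -big_split /=.
under [RHS]eq_bigr do rewrite -big_split /=.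
rewrite -(bigA_distr_bigA (fun i (t : 'I_r.+1) => B t * t%:R ^+ e i)).
rewrite -(bigA_distr_bigA (fun i (t : 'I_r.+1) =>
   ((t == 0%N :> nat)%:R + A t) * t%:R ^+ e i)).
apply: eq_bigr => i _; rewrite -momAB; last first.
  by apply: leq_trans ed; rewrite (bigD1 i) //= leq_addr.
under [RHS]eq_bigr do rewrite mulrDl.
by rewrite big_split /= (sum_ord_delta (fun t => t%:R ^+ e i)).
Qed.

Let d_lt : (2 * d <= m)%N. Proof. by have := leq_divM m 128; lia. Qed.

(** Since B 1 >= 1/2, a factor A - a delta_1 is at most 2 B in absolute value and a factor a delta_1
    at most 2 a B. With at most d factors of the first kind and at most 2^m sets, the ratio to the
    product of the B is at most 2^(d + m) (2 a)^(m - d) <= (16 a)^(m - d) <= 1/2, using 2 d <= m and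
    a <= 1/32. *)
Lemma kappa_bound (y : point) : `|kappa y| <= 1 / 2 * \prod_i B (y i).
Proof.
have PB : 0 <= \prod_i B (y i) by apply: prodr_ge0.
have a1 : 2 * a <= 1 by move: massA; rewrite -/a; lra.
apply: le_trans (ler_norm_sum _ _ _) _.
apply: (@le_trans _ _ (\sum_(S : {set 'I_m} | (#|S| <= d)%N)
    2 ^+ d * (2 * a) ^+ (m - d) * \prod_i B (y i))).
  apply: ler_sum => S Sd.
  apply: (@le_trans _ _ (\prod_i (if i \in S then 2 else 2 * a) * \prod_i B (y i))).
    rewrite /P1 normr_prod -big_split /=; apply: ler_prod => i _; rewrite normr_ge0 /=.
    have h1 : a * (y i == 1%N :> nat)%:R <= 2 * a * B (y i).
      case: eqP => [->|_]; last by rewrite mulr0 mulr_ge0 // mulr_ge0.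
      by rewrite mulr1; have := ler_wpM2l a_ge0 B1; lra.
    case: ifP => _; last by rewrite ger0_norm // mulr_ge0.
    have A2B : A (y i) <= 2 * B (y i).
      case: (y i) => -[|t] tr /=; first by rewrite AB0.1 AB0.2 mulr0.
      by have [_ _ ] := ABle (ltn0Sn t).
    rewrite ler_norml; case: eqP => [e|_]; last first.
      by move: A2B (A_ge0 (y i)); rewrite mulr0 subr0 => *; apply/andP; split; lra.
    move: A2B (A_ge0 1) A1_le_a B1 a1; rewrite e mulr1 => *.
    by apply/andP; split; lra.
  rewrite ler_wpM2r // (bigID (mem S)) /=.
  rewrite (eq_bigr (fun=> 2)) => [|i iS]; last by rewrite iS.
  rewrite [X in _ * X](eq_bigr (fun=> 2 * a)) => [|i iS]; last by rewrite (negbTE iS).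
  rewrite !prodr_const; apply: ler_pM; rewrite ?exprn_ge0 ?mulr_ge0 //.
    by rewrite ler_weXn2l //; lra.
  rewrite (_ : #|_| = (m - #|S|)%N); last first.
    transitivity #|[predC mem S]|; first by apply: eq_card => i; rewrite !inE.
    by have := cardC (mem S); rewrite card_ord => /(congr1 (subn^~ #|S|)); rewrite addKn.
  by apply: ler_wiXn2l; [rewrite mulr_ge0|exact: a1|lia].
rewrite sumr_const -mulrnAl ler_wpM2r //.
apply: (@le_trans _ _ (2 ^+ d * (2 * a) ^+ (m - d) * 2 ^+ m)).
  rewrite -mulr_natr ler_wpM2l ?mulr_ge0 ?exprn_ge0 ?mulr_ge0 // -natrX ler_nat.
  by rewrite (leq_trans (max_card _)) // -cardsT -powersetT card_powerset cardsT card_ord.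
have -> : 2 ^+ d * (2 * a) ^+ (m - d) * 2 ^+ m = 2 ^+ (d + m) * (2 * a) ^+ (m - d) :> R.
  by rewrite exprD; ring.
apply: (@le_trans _ _ (2 ^+ (3 * (m - d)) * (2 * a) ^+ (m - d))).
  rewrite ler_wpM2r ?exprn_ge0 ?mulr_ge0 // ler_weXn2l //; [lra|lia].
rewrite exprM -exprMn.
apply: (@le_trans _ _ ((1 / 2) ^+ (m - d))).
  apply: lerXn2r; rewrite ?nnegrE ?mulr_ge0 ?exprn_ge0 //; try lra.
  by move: massA; rewrite -/a; lra.
rewrite -[X in _ <= X]expr1; apply: ler_wiXn2l; [lra|lra|].
by lia.
Qed.

Let block_true_ge (y : point) : 1 / 2 * \prod_i B (y i) <= block_measure true y.
Proof. by have := le_trans (ler_norm _) (kappa_bound y); rewrite /=; lra. Qed.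

Let block_true_le (y : point) : block_measure true y <= 3 / 2 * \prod_i B (y i).
Proof.
have := kappa_bound y; rewrite ler_norml /= => /andP[h _]; lra.
Qed.

Let prodB_ge0 (y : point) : 0 <= \prod_i B (y i).
Proof. exact: prodr_ge0. Qed.

Let prod_zero (F : nat -> R) (y : point) i : F 0%N = 0 -> y i = 0%N :> nat ->
  \prod_i F (y i) = 0.
Proof. by move=> F0 yi; rewrite (bigD1 i) //= yi F0 mul0r. Qed.

Let block_false_pos (y : point) : (forall i, (0 < y i)%N) ->
  block_measure false y = 0.
Proof.
move=> pos; rewrite /block_measure; apply/eqP; rewrite subr_eq0; apply/eqP.
by apply: eq_bigr => i _; rewrite gtn_eqF // add0r.
Qed.

Let block_false_zero (y : point) i : y i = 0%N :> nat ->
  block_measure false y = \prod_i ((y i == 0%N :> nat)%:R + A (y i)).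
Proof. by move=> yi; rewrite /block_measure (prod_zero _ yi) ?subr0 // AB0.1. Qed.

Lemma block_measure_ge0 b (y : point) : 0 <= block_measure b y.
Proof.
case: b; first by apply: le_trans (block_true_ge y); rewrite mulr_ge0.
case: (pickP (fun i => y i == 0%N :> nat)) => [i /eqP yi|pos].
  by rewrite (block_false_zero yi); apply: prodr_ge0 => j _; rewrite addr_ge0.
by rewrite block_false_pos // => i; rewrite lt0n pos.
Qed.

Lemma block_measure_supp b (y : point) : block_measure b y != 0 -> [forall i, (0 < y i)%N] = b.
Proof.
case: b => nz; last first.
  apply/negbTE; apply: contra nz => /forallP pos.
  by rewrite block_false_pos.
apply/forallP => i; rewrite lt0n; apply: contra nz => /eqP yi.
rewrite eq_le block_measure_ge0 andbT; apply: le_trans (block_true_le y) _.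
by rewrite (prod_zero _ yi) ?mulr0 // AB0.2.
Qed.

Let hi_ge0 t : (0 < t)%N -> 0 <= base_hi t.
Proof.
by move=> t0; have [_ _ _ h _] := ABle t0; apply: le_trans h.
Qed.

(** L_1 lies between 1/2 and 3/2 of the product of the B; the resulting factor 3 is paid by one
    coordinate of S, and an empty S forces x = y. For L_0 either y has no zero and L_0 vanishes
    there, or x and y share a zero and L_0 is a genuine product at both. *)
Lemma block_measure_movable b :
  movable base_lo (fun t => 3 * base_hi t) (block_measure b).
Proof.
have lo0 t : 0 <= base_lo t by rewrite ltW ?base_lo_gt0.
move=> S x y xy pos.
have hiS : 0 <= \prod_(i in S) base_hi (y i).
  by apply: prodr_ge0 => i /pos[_ y0]; exact: hi_ge0.
have loS : 0 <= \prod_(i in S) base_lo (x i) by apply: prodr_ge0.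
case: b.
  have [S0|[j jS]] := set_0Vmem S.
    rewrite S0 !big_set0 !mulr1 (_ : x = y) //.
    by apply/ffunP => i; rewrite xy // S0 inE.
  have mv : movable base_lo base_hi (fun y : point => \prod_i B (y i)).
    by apply: movable_prod => // t t0; have [_ h1 _ _ h2] := ABle t0; rewrite ?lo0.
  have h := mv S x y xy pos.
  apply: le_trans (ler_wpM2r loS (block_true_le y)) _.
  apply: (@le_trans _ _ (3 * (block_measure true x * \prod_(i in S) base_hi (y i)))).
    have := ler_wpM2r hiS (block_true_ge x); move: h.
    by rewrite -[3 / 2 * _ * _]mulrA -[1 / 2 * _ * _]mulrA; lra.
  rewrite mulrCA ler_wpM2l ?block_measure_ge0 //.
  rewrite [X in _ <= X]big_split /= ler_wpM2r // prodr_const.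
  rewrite -[X in X <= _]expr1; apply: ler_weXn2l; first lra.
  by apply/card_gt0P; exists j.
case: (pickP (fun i => y i == 0%N :> nat)) => [i /eqP yi|ypos]; last first.
  rewrite block_false_pos; last by move=> i; rewrite lt0n ypos.
  rewrite mul0r mulr_ge0 ?block_measure_ge0 //; apply: prodr_ge0 => i /pos[_ y0].
  by rewrite mulr_ge0 ?hi_ge0.
have iS : i \notin S by apply/negP => /pos[_]; rewrite yi.
have xi : x i = 0%N :> nat by rewrite xy.
rewrite (block_false_zero yi) (block_false_zero xi).
suff mv : movable base_lo (fun t => 3 * base_hi t)
    (fun y : point => \prod_i ((y i == 0%N :> nat)%:R + A (y i))) by exact: mv.
apply: (movable_prod (F := fun t => (t == 0%N)%:R + A t)) => t.
- by rewrite addr_ge0.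
- by move=> t0; have [h _ _ _ _] := ABle t0; rewrite lo0 gtn_eqF // add0r.
move=> t0; have [_ _ _ h _] := ABle t0; rewrite gtn_eqF // add0r.
by have := hi_ge0 t0; lra.
Qed.

Lemma block_measure_mass_gt0 : 0 < \sum_(y : point) block_measure true y.
Proof.
rewrite (bigD1 [ffun=> inord 1]) // ltr_wpDr //.
  by apply: sumr_ge0 => y _; exact: block_measure_ge0.
apply: lt_le_trans (block_true_ge _).
apply: mulr_gt0; first lra.
apply: prodr_gt0 => i _; rewrite ffunE inordK ?ltnS //; apply: lt_le_trans B1; lra.
Qed.

End BlockDual.

Lemma block_dual (R : realType) (m : nat) : (0 < m)%N ->
  exists L : bool -> {ffun 'I_m -> 'I_(m ^ 2).+1} -> R,
  [/\ forall b y, 0 <= L b y, forall b, \sum_y L b y = 1,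
      forall b y, L b y != 0 -> [forall i, (0 < y i)%N] = b,
      forall b, movable (base_lo R) (fun t => 3 * base_hi R m t) (L b) &
      forall e : 'I_m -> nat, (\sum_i e i <= m %/ 128)%N ->
        \sum_y L true y * \prod_i (y i)%:R ^+ e i =
        \sum_y L false y * \prod_i (y i)%:R ^+ e i].
Proof.
move=> m0; have [A [B [momAB AB0 ABle massA B1]]] := base_pair R m0.
pose L0 := @block_measure R m A B.
pose W := \sum_y L0 true y.
have W0 : 0 < W by apply: block_measure_mass_gt0.
have Lge0 b y : 0 <= L0 b y by apply: block_measure_ge0.
have massL b : \sum_y L0 b y = W.
  case: b => //; have := block_moment m0 momAB (e := fun=> 0%N).
  rewrite sum_nat_const muln0 leq0n -/L0 => /(_ isT).
  have E (b : bool) : \sum_y L0 b y * \prod_i (y i)%:R ^+ 0 = \sum_y L0 b y.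
    by apply: eq_bigr => y _; rewrite big1 ?mulr1.
  by rewrite !E => <-.
exists (fun b y => L0 b y / W); split.
- by move=> b y; rewrite divr_ge0 // ltW.
- by move=> b; rewrite -mulr_suml massL divff // gt_eqF.
- move=> b y nz; apply: (@block_measure_supp R m A B) => //.
  by apply: contraNneq nz => h; rewrite -/(L0 b y) /L0 h mul0r.
- move=> b S x y xy pos /=; rewrite mulrAC [X in _ <= X]mulrAC ler_wpM2r ?invr_ge0 ?(ltW W0) //.
  exact: (block_measure_movable m0 AB0 ABle massA B1 b xy pos).
move=> e ed.
have E (b : bool) : \sum_y L0 b y / W * \prod_i (y i)%:R ^+ e i =
    (\sum_y L0 b y * \prod_i (y i)%:R ^+ e i) / W.
  by rewrite mulr_suml; apply: eq_bigr => y _; rewrite mulrAC.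
by rewrite !E /L0 (block_moment m0 momAB).
Qed.

(** * Truncation to small weight *)

(** Greedy choice: starting from all of I, discard a coordinate below tau |S| as long as there is
    one; the coordinate discarded at size s weighs less than tau s. *)
Lemma heavy_set (R : realType) (I : finType) (tau : nat -> R) (y : I -> nat) :
  exists S : {set I}, (forall i, i \in S -> tau #|S| <= (y i)%:R) /\
    \sum_(i | i \notin S) (y i)%:R <= \sum_(#|S|.+1 <= s < #|I|.+1) tau s.
Proof.
suff H k (S : {set I}) : #|S| = k ->
    \sum_(i | i \notin S) (y i)%:R <= \sum_(k.+1 <= s < #|I|.+1) tau s ->
    exists S : {set I}, (forall i, i \in S -> tau #|S| <= (y i)%:R) /\
      \sum_(i | i \notin S) (y i)%:R <= \sum_(#|S|.+1 <= s < #|I|.+1) tau s.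
  apply: (H #|I| [set: I]%SET); first by rewrite cardsT.
  by rewrite big_geq // big1 // => i; rewrite inE.
elim: k S => [|k IH] S Sk Sle.
  exists S; split; last by rewrite Sk.
  by move: Sk => /eqP; rewrite cards_eq0 => /eqP -> i; rewrite inE.
case: (pickP (fun i => (i \in S) && ((y i)%:R < tau #|S|))) => [i /andP[iS yi]|none].
  apply: (IH (S :\ i)); first by apply: succn_inj; rewrite -Sk (cardsD1 i S) iS.
  have kI : (k.+1 < #|I|.+1)%N by rewrite ltnS -Sk max_card.
  rewrite big_ltn // (bigD1 i) /=; last by rewrite !inE eqxx.
  rewrite lerD //; first by rewrite -Sk ltW.
  apply: le_trans Sle; rewrite le_eqVlt; apply/orP; left; apply/eqP.
  by apply: eq_bigl => j; rewrite !inE; case: (eqVneq j i) => [->|] /=; rewrite ?iS ?andbT.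
exists S; split; last by rewrite Sk.
by move=> i iS; have := none i; rewrite iS /= => /negbT; rewrite -leNgt.
Qed.

(* With T = t - 1 and b = x - 1, this is the coefficient of f(1 + b) in the    *)
(* order-a term 'C(T, a) Delta^a f(1) of Newton's forward formula for f(1 + T).*)
Definition newton (R : pzRingType) (a t x : nat) : R :=
  if x is b.+1 then 'C(t.-1, a)%:R * ((-1) ^+ (a - b) * 'C(a, b)%:R) else 0.

Section NewtonKernel.
Variable R : realType.

(** Newton's formula of full order is exact: compare coefficients in X^(t-1) = (1 + (X -
    1))^(t-1). *)
Lemma newton_sum (r t x : nat) : (0 < t <= r)%N ->
  \sum_(a < r.+1) newton R a t x = (t == x)%:R.
Proof.
case: t => // t tr; case: x => [|b] /=; first by rewrite big1.
have coefXB1 (a : nat) : (('X - 1 : {poly R}) ^+ a)`_b = (-1) ^+ (a - b) * 'C(a, b)%:R.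
  rewrite addrC exprDn coef_sum.
  transitivity (\sum_(i < a.+1) (i == b :> nat)%:R * ((-1) ^+ (a - i) * 'C(a, i)%:R) : R).
    apply: eq_bigr => i _; rewrite coefMn.
    have -> : (-1) ^+ (a - i) = ((-1) ^+ (a - i))%:P :> {poly R}.
      by rewrite rmorphXn rmorphN rmorph1.
    by rewrite coefCM coefXn eq_sym -mulr_natr; ring.
  have [ba|ab] := leqP b a; first by rewrite (sum_ord_delta
    (fun i => (-1) ^+ (a - i) * 'C(a, i)%:R)).
  rewrite bin_small // mulr0 big1 // => i _; case: eqP => [e|_]; last by rewrite mul0r.
  by have := ltn_ord i; lia.
under eq_bigr do rewrite -coefXB1.
have <- : (('X : {poly R}) ^+ t)`_b = (t.+1 == b.+1)%:R by rewrite coefXn eqSS eq_sym.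
rewrite -[in RHS](subrK 1 'X) [in RHS](addrC _ 1) exprDn coef_sum.
pose G (a : nat) : R := 'C(t, a)%:R * (('X - 1 : {poly R}) ^+ a)`_b.
transitivity (\sum_(0 <= a < r.+1) G a); first by rewrite big_mkord.
rewrite (big_cat_nat (n := t.+1)) //=; last lia.
have -> : \sum_(t.+1 <= i < r.+1) G i = 0.
  rewrite big_nat_cond; apply: big1 => i /andP[/andP[ti _] _].
  by rewrite /G bin_small // mul0r.
rewrite addr0.
rewrite big_mkord; apply: eq_bigr => i _.
by rewrite /G expr1n mul1r coefMn mulr_natl.
Qed.

Lemma newton_orth (r a t e : nat) : (t <= r)%N -> (e < a)%N ->
  \sum_(x < r.+1) newton R a t x * x%:R ^+ e = 0.
Proof.
move=> tr ea; rewrite big_ord_recl /= mul0r add0r.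
have [at1|ta] := leqP a t.-1; last first.
  by rewrite big1 // => b _; rewrite bin_small // !mul0r.
transitivity ('C(t.-1, a)%:R * (-1) ^+ a *
   \sum_(b < a.+1) (-1) ^+ b * 'C(a, b)%:R * (b%:R + 1) ^+ e : R); last first.
  by rewrite sum_alt_bin_pow // mulr0.
rewrite mulr_sumr.
pose F (b : nat) : R := newton R a t b.+1 * b.+1%:R ^+ e.
transitivity (\sum_(0 <= b < r) F b); first by rewrite big_mkord.
rewrite (big_cat_nat (n := a.+1)) //=; last lia.
have -> : \sum_(a.+1 <= b < r) F b = 0.
  rewrite big_nat_cond; apply: big1 => b /andP[/andP[ab _] _].
  by rewrite /F /= (bin_small ab) !mulr0 mul0r.
rewrite addr0.
rewrite big_mkord; apply: eq_bigr => b _; rewrite /F /= natr1.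
have -> : (-1) ^+ (a - b) = (-1) ^+ a * (-1) ^+ b :> R.
  by rewrite -exprD -signr_odd oddB -?oddD ?signr_odd // -ltnS ltn_ord.
ring.
Qed.

(** The coefficients are at most 2^a 'C(t - 1, a), so the sum is at most (1 + 2 z)^(t-1). *)
Lemma newton_abs (r t x : nat) (z : R) : 0 <= z ->
  \sum_(a < r.+1) `|newton R a t x| * z ^+ a <= expR (2 * z * t%:R).
Proof.
move=> z0; have z2 : 0 <= 2 * z by rewrite mulr_ge0.
apply: (@le_trans _ _ (\sum_(a < r.+1) (2 * z) ^+ a *+ 'C(t.-1, a))).
  apply: ler_sum => a _; case: x => [|b] /=.
    by rewrite normr0 mul0r mulrn_wge0 // exprn_ge0.
  rewrite !normrM !normr_nat normr_sign mul1r exprMn.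
  rewrite -[X in _ <= X]mulr_natl -mulrA ler_wpM2l // ler_wpM2r ?exprn_ge0 //.
  rewrite -natrX ler_nat -[2%N]/(1 + 1)%N expnDn.
  have [ba|ab] := leqP b a; last by rewrite bin_small.
  rewrite (bigD1 (inord b)) //= inordK ?ltnS // !exp1n !mul1n muln1 leq_addr //.
apply: (@le_trans _ _ ((1 + 2 * z) ^+ t.-1)).
  rewrite exprDn; under [X in _ <= X]eq_bigr do rewrite expr1n mul1r.
  pose G (a : nat) : R := (2 * z) ^+ a *+ 'C(t.-1, a).
  have G0 a : 0 <= G a by rewrite mulrn_wge0 // exprn_ge0.
  rewrite -(big_mkord predT G) -[X in _ <= X](big_mkord predT G).
  have [le|lt] := leqP r.+1 t.-1.+1.
    by rewrite [X in _ <= X](big_cat_nat (n := r.+1)) //= lerDl sumr_ge0.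
  rewrite (big_cat_nat (n := t.-1.+1)) //=; last exact: ltnW.
  have -> : \sum_(t.-1.+1 <= i < r.+1) G i = 0.
    rewrite big_nat_cond; apply: big1 => i /andP[/andP[ti _] _].
    by rewrite /G bin_small.
  by rewrite addr0.
rewrite expRM_natr.
apply: (@le_trans _ _ (expR (2 * z) ^+ t.-1)).
  by apply: lerXn2r; rewrite ?nnegrE ?addr_ge0 ?expR_ge0 // expR_ge1Dx.
apply: ler_weXn2l; last exact: leq_pred.
by rewrite -[X in X <= _]expR0 ler_expR.
Qed.

End NewtonKernel.

(** Off S only order 0 is present, with the identity kernel, so those coordinates stay put. *)
Definition kern (R : pzRingType) (inS : bool) (a t x : nat) : R :=
  if inS then newton R a t x else (a == 0)%N%:R * (t == x)%:R.

Lemma kern_sum (R : realType) (inS : bool) (r t x : nat) :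
  (inS ==> (0 < t))%N -> (t <= r)%N ->
  \sum_(a < r.+1) kern R inS a t x = (t == x)%:R.
Proof.
case: inS => /= [t0|_] tr; first by rewrite newton_sum // t0.
by rewrite (sum_ord_delta (fun=> (t == x)%:R)).
Qed.

Lemma kern_orth (R : realType) (inS : bool) (r a t e : nat) :
  (t <= r)%N -> (e < a)%N -> \sum_(x < r.+1) kern R inS a t x * x%:R ^+ e = 0.
Proof.
case: inS => tr ea; first exact: newton_orth.
by rewrite big1 // => x _; rewrite /kern gtn_eqF ?mul0r //; case: a ea.
Qed.

Section Correction.
Variables (R : realType) (I : finType) (r D : nat).
Notation point := {ffun I -> 'I_r.+1}.

(** Multivariate Newton interpolation in the coordinates of S, cut at total order D. *)
Definition corr (S : {set I}) (y x : point) : R :=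
  \sum_(al : point | (\sum_i al i <= D)%N) \prod_i kern R (i \in S) (al i) (y i) (x i).

(** All orders together reproduce y. A term of total order above D has al_i > e_i for some i, where
    its difference kills x_i^(e_i), so cutting loses nothing. *)
Lemma corr_moment (S : {set I}) (y : point) (e : I -> nat) :
  (forall i, i \in S -> (0 < y i)%N) -> (\sum_i e i <= D)%N ->
  \sum_(x : point) corr S y x * \prod_i (x i)%:R ^+ e i =
  \prod_i (y i)%:R ^+ e i.
Proof.
move=> ypos eD.
pose T (al : point) := \prod_i \sum_(x < r.+1)
  kern R (i \in S) (al i) (y i) x * x%:R ^+ e i.
transitivity (\sum_(al : point | (\sum_i al i <= D)%N) T al).
  rewrite /corr; under eq_bigr do rewrite mulr_suml.
  rewrite exchange_big /=; apply: eq_bigr => al _.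
  under eq_bigr do rewrite -big_split /=.
  by rewrite /T bigA_distr_bigA.
transitivity (\sum_(al : point) T al).
  rewrite [RHS](bigID (fun al : point => (\sum_i al i <= D)%N)) /=.
  rewrite [X in _ = _ + X]big1 ?addr0 // => al; rewrite -ltnNge => Dal.
  case: (pickP (fun i => (e i < al i)%N)) => [i ei|none].
    by rewrite /T (bigD1 i) //= kern_orth ?mul0r // -ltnS.
  have h : (\sum_i al i <= \sum_i e i)%N.
    by apply: leq_sum => i _; have := none i; rewrite ltnNge => /negbFE.
  by move: Dal; rewrite ltnNge (leq_trans h eD).
rewrite /T -(bigA_distr_bigA (fun i (a : 'I_r.+1) => \sum_(x < r.+1)
  kern R (i \in S) a (y i) x * x%:R ^+ e i)).
apply: eq_bigr => i _; rewrite exchange_big /=.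
have yr : (y i <= r)%N by rewrite -ltnS.
rewrite -[RHS](sum_ord_delta (r := r) (fun x => x%:R ^+ e i)) //.
apply: eq_bigr => x _; rewrite -mulr_suml kern_sum //; first by rewrite eq_sym.
by apply/implyP => /ypos.
Qed.

Lemma corr_supp (S : {set I}) (y x : point) : corr S y x != 0 ->
  [/\ forall i, i \notin S -> x i = y i, forall i, i \in S -> (0 < x i)%N &
      (\sum_(i in S) x i <= #|S| + D)%N].
Proof.
move=> nz.
have [al alD kal] : exists2 al : point, (\sum_i al i <= D)%N &
    forall i, kern R (i \in S) (al i) (y i) (x i) != 0.
  case: (pickP (fun al : point => (\sum_i al i <= D)%N &&
    [forall i, kern R (i \in S) (al i) (y i) (x i) != 0])) => [al|none].
    by case/andP=> alD /forallP kal; exists al.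
  move: nz; rewrite /corr big1 ?eqxx // => al alD.
  have := none al; rewrite alD /= => /negbT; rewrite negb_forall => /existsP[i].
  by rewrite negbK => /eqP ki; rewrite (bigD1 i) //= ki mul0r.
have onS i : i \in S -> (0 < x i <= (al i).+1)%N.
  move=> iS; have := kal i; rewrite iS /= /newton; case: (x i : nat) => [|b] /=.
    by rewrite eqxx.
  by rewrite !mulf_eq0 !negb_or => /and3P[_ _]; rewrite pnatr_eq0 -lt0n bin_gt0.
split.
- move=> i iS; have := kal i; rewrite (negbTE iS) /kern mulf_eq0 negb_or.
  move=> /andP[_]; rewrite pnatr_eq0 eqb0 negbK => /eqP yx.
  by apply: val_inj; rewrite /= yx.
- by move=> i /onS /andP[].
rewrite -sum1_card; apply: (@leq_trans (\sum_(i in S) 1 + \sum_(i in S) al i)).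
  by rewrite -big_split /=; apply: leq_sum => i /onS /andP[_]; rewrite add1n.
rewrite leq_add2l (leq_trans _ alD) // [X in (_ <= X)%N](bigID (mem S)) /=.
exact: leq_addr.
Qed.

(** For z <= 1 and total order at most D the weight z^(order - D) is at least 1; inserting it makes
    the sum factor over the coordinates. *)
Lemma corr_bound (S : {set I}) (y x : point) (z : R) : 0 < z <= 1 ->
  `|corr S y x| <= z ^- D *
    \prod_i (if i \in S then expR (2 * z * (y i)%:R) else (x i == y i)%:R).
Proof.
case/andP=> z0 z1; have zle : 0 <= z by exact: ltW.
pose K i (a : nat) : R := `|kern R (i \in S) a (y i) (x i)| * z ^+ a.
have K0 i a : 0 <= K i a by rewrite mulr_ge0 // exprn_ge0.
apply: (@le_trans _ _ (z ^- D * \prod_i \sum_(a < r.+1) K i a)); last first.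
  rewrite ler_wpM2l ?invr_ge0 ?exprn_ge0 //; apply: ler_prod => i _.
  rewrite sumr_ge0 //= /K /kern; case: (i \in S); first exact: newton_abs.
  under eq_bigr do rewrite normrM !normr_nat -mulrA.
  by rewrite (sum_ord_delta (fun a => (y i == x i :> nat)%:R * z ^+ a)) // expr0 mulr1 eq_sym.
rewrite bigA_distr_bigA mulr_sumr /=.
apply: le_trans (ler_norm_sum _ _ _) _; rewrite big_mkcond /=.
apply: ler_sum => al _; case: ifP => alD; last first.
  by rewrite mulr_ge0 ?invr_ge0 ?exprn_ge0 // prodr_ge0.
rewrite big_split /= normr_prod mulrCA ler_peMr ?prodr_ge0 //.
rewrite prodrXr mulrC ler_pdivlMr ?exprn_gt0 // mul1r.
exact: ler_wiXn2l.
Qed.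

End Correction.

(** * Moving the mass of heavy points to small weight *)

Section Truncation.
Variables (R : realType) (I : finType) (r D theta m : nat).
Notation point := {ffun I -> 'I_r.+1}.
Variables (L : point -> R) (tau : nat -> R).

(** The price of one coordinate of S: 64 * 4 from [base_lo], times the constant in 3 [base_hi]. *)
Definition tail_const : R := 256 * (3 * (8 * 256 * 256)).

Let beta : R := (3 * (128 * m))%:R.

Hypothesis m0 : (0 < m)%N.
Hypothesis L0 : forall y, 0 <= L y.
Hypothesis Lmov : movable (base_lo R) (fun t => 3 * base_hi R m t) L.
Hypothesis tau0 : forall s, (0 < s)%N -> 0 < tau s.
Hypothesis tau_sum : \sum_(1 <= s < #|I|.+1) tau s <= theta%:R / 2.
Hypothesis tau_tail :
  \sum_(S : {set I} | (0 < #|S|)%N) (tail_const * (2 / tau #|S|)) ^+ #|S| <= 1.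
Hypothesis theta_exp : (16 * beta) ^+ D <= expR (theta%:R / (4 * beta)).
Hypothesis theta_ge : ((#|I| + D)%:R : R) <= theta%:R / 2.

Let beta0 : 0 < beta. Proof. by rewrite ltr0n !muln_gt0 m0. Qed.

Let onsum (S : {set I}) (y : point) : R := \sum_(i in S) (y i)%:R.
Let offsum (S : {set I}) (y : point) : R := \sum_(i | i \notin S) (y i)%:R.

Let heavy (S : {set I}) (y : point) : bool :=
  [&& (0 < #|S|)%N, [forall i, (i \in S) ==> (tau #|S| <= (y i)%:R)],
      offsum S y <= theta%:R / 2 & theta%:R / 2 <= onsum S y].

Let heavy_exists (y : point) : (theta < \sum_i y i)%N -> exists S, heavy S y.
Proof.
move=> yth; have [S [Stau Soff]] := heavy_set tau (fun i => y i : nat).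
have off : offsum S y <= theta%:R / 2.
  apply: le_trans Soff (le_trans _ tau_sum).
  rewrite [X in _ <= X](big_cat_nat (n := #|S|.+1)) //=; last by rewrite ltnS max_card.
  by rewrite lerDr big_nat_cond sumr_ge0 // => s /andP[/andP[s0 _] _]; rewrite ltW ?tau0.
have tot : theta%:R < onsum S y + offsum S y.
  have -> : onsum S y + offsum S y = (\sum_i y i)%:R.
    by rewrite natr_sum [RHS](bigID (mem S)) /=.
  by rewrite ltr_nat.
have on : theta%:R / 2 <= onsum S y by move: off tot; lra.
exists S; apply/and4P; split=> //; last by apply/forallP => i; apply/implyP/Stau.
rewrite lt0n cards_eq0; apply/eqP => S0; move: tot off.
rewrite /onsum S0 big_set0.
have th0 : 0 <= theta%:R :> R by [].
by lra.
Qed.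

Let heavy_pos S y i : heavy S y -> i \in S -> (0 < y i)%N.
Proof.
move=> /and4P[S0 /forallP Stau _ _] iS; have /implyP/(_ iS) h := Stau i.
by have := lt_le_trans (tau0 S0) h; rewrite ltr0n.
Qed.

Let h (s t : nat) : R :=
  tail_const * (((0 < t)%N && (tau s <= t%:R))%:R / t%:R ^+ 2).

Let tail_const_ge0 : 0 <= tail_const. Proof. by rewrite !mulr_ge0. Qed.

Let h_ge0 s t : 0 <= h s t.
Proof. by rewrite /h mulr_ge0 // divr_ge0 // exprn_ge0. Qed.

Let move_cost S (x y : point) : heavy S y -> corr R D S y x != 0 ->
  L y <= 4 ^+ D * L x * \prod_(i in S) (256 * (3 * base_hi R m (y i))).
Proof.
move=> hS nz; have [xoff xon xsum] := corr_supp nz.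
have mv : L y * \prod_(i in S) base_lo R (x i) <=
    L x * \prod_(i in S) (3 * base_hi R m (y i)).
  by apply: Lmov => // i iS; split; [exact: xon|exact: heavy_pos iS].
(* A coordinate x_i costs 64 * 4^(x_i), and the x_i on S add up to at most |S| + D. *)
have lo : (256^-1) ^+ #|S| * 4 ^- D <= \prod_(i in S) base_lo R (x i).
  rewrite /base_lo big_split /= prodr_const prodfV prodrXr.
  have -> : 256^-1 ^+ #|S| * 4 ^- D = (1 / 64) ^+ #|S| * 4 ^- (#|S| + D) :> R.
    rewrite exprD invfM mulrA -[4 ^- #|S|]exprVn -exprMn; congr (_ ^+ _ * _).
    by field.
  rewrite ler_wpM2l ?exprn_ge0 ?divr_ge0 // lef_pV2 ?posrE ?exprn_gt0 //.
  by apply: ler_weXn2l => //; lra.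
have := le_trans (ler_wpM2l (L0 y) lo) mv.
have -> : \prod_(i in S) (256 * (3 * base_hi R m (y i))) =
    256 ^+ #|S| * \prod_(i in S) (3 * base_hi R m (y i)).
  by rewrite [LHS]big_split /= prodr_const.
set P := \prod_(i in S) _; rewrite exprVn.
have p1 : 0 < 256 ^+ #|S| :> R by rewrite exprn_gt0.
have p2 : 0 < 4 ^+ D :> R by rewrite exprn_gt0.
rewrite -invfM ler_pdivrMr ?mulr_gt0 // => /le_trans; apply.
by rewrite le_eqVlt; apply/orP; left; apply/eqP; ring.
Qed.

(** With z = 1 / (4 beta) the kernel grows like exp(y_i / (2 beta)) and uses up half of the decay
    exp(-y_i / beta). The other half, over weight at least theta / 2 on S, pays for 4^D z^-D = (16
    beta)^D. *)
Let corr_cost S (x y : point) : heavy S y -> corr R D S y x != 0 ->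
  L y * `|corr R D S y x| <=
  L x * \prod_i (if i \in S then h #|S| (y i) else (x i == y i)%:R).
Proof.
move=> hS nz; have [xoff xon xsum] := corr_supp nz.
have z0 : 0 < (4 * beta)^-1 by rewrite invr_gt0 mulr_gt0.
have z1 : (4 * beta)^-1 <= 1.
  rewrite invf_le1 ?mulr_gt0 //.
  have : 1 <= beta by rewrite ler1n !muln_gt0 m0.
  by lra.
have cb := @corr_bound R I r D S y x (4 * beta)^-1 (introT andP (conj z0 z1)).
have toS (F : I -> R) : \prod_i (if i \in S then F i else (x i == y i)%:R) =
    \prod_(i in S) F i.
  rewrite [RHS]big_mkcond; apply: eq_bigr => i _; case: ifP => // /negbT iS.
  by rewrite xoff // eqxx.
rewrite toS; rewrite toS in cb.
apply: le_trans (ler_pM (L0 y) (normr_ge0 _) (move_cost hS nz) cb) _.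
have hE i : i \in S -> 256 * (3 * base_hi R m (y i)) *
    expR (2 * (4 * beta)^-1 * (y i)%:R) =
    h #|S| (y i) * expR (- ((y i)%:R / (2 * beta))).
  move=> iS; have yi := heavy_pos hS iS.
  move: hS => /and4P[S0 /forallP/(_ i)/implyP/(_ iS) ti _ _].
  rewrite /h yi ti /= mul1r /base_hi /decay -/beta /tail_const.
  have -> : - ((y i)%:R / (2 * beta)) =
      - ((y i)%:R / beta) + 2 * (4 * beta)^-1 * (y i)%:R.
    have : beta != 0 by rewrite gt_eqF.
    by move: beta => b b0; field.
  by rewrite expRD; ring.
rewrite [X in X <= _]mulrACA -big_split /= (eq_bigr _ hE) big_split /= -expR_sum.
set P := \prod_(i in S) h _ _.
have P0 : 0 <= P by apply: prodr_ge0.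
have sE : \sum_(i in S) - ((y i)%:R / (2 * beta)) = - (onsum S y / (2 * beta)).
  by rewrite sumrN mulr_suml.
have key : 4 ^+ D * ((4 * beta)^-1) ^- D * expR (- (onsum S y / (2 * beta))) <= 1.
  rewrite -exprVn invrK -exprMn (_ : 4 * (4 * beta) = 16 * beta); last by ring.
  rewrite expRN ler_pdivrMr ?expR_gt0 // mul1r; apply: le_trans theta_exp _.
  move: hS => /and4P[_ _ _ on].
  rewrite ler_expR (_ : theta%:R / (4 * beta) = theta%:R / 2 / (2 * beta)).
    by rewrite ler_pM2r // invr_gt0 mulr_gt0.
  have : beta != 0 by rewrite gt_eqF.
  by move: beta => b b0; field.
rewrite sE; apply: le_trans (ler_piMr (mulr_ge0 (L0 x) P0) key).
by rewrite le_eqVlt; apply/orP; left; apply/eqP; ring.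
Qed.

Let corr_weight S (x y : point) : heavy S y -> corr R D S y x != 0 ->
  (\sum_i x i <= theta)%N.
Proof.
move=> /and4P[_ _ off _] nz; have [xoff xon xsum] := corr_supp nz.
rewrite -(ler_nat R) (bigID (mem S)) /= natrD.
have h1 : (\sum_(i in S) x i)%:R <= theta%:R / 2 :> R.
  apply: le_trans theta_ge; rewrite ler_nat (leq_trans xsum) // leq_add2r.
  exact: max_card.
have h2 : (\sum_(i | i \notin S) x i)%:R <= theta%:R / 2 :> R.
  apply: le_trans off; rewrite natr_sum /offsum le_eqVlt; apply/orP; left; apply/eqP.
  by apply: eq_bigr => i iS; rewrite xoff.
by lra.
Qed.

(** Each point of weight above theta is replaced by its signed combination [corr]. What arrives at x
    is at most L x in absolute value, so the new measure stays nonnegative and each mass at most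
    doubles. *)
Lemma truncation : exists Lt : point -> R,
  [/\ forall x, 0 <= Lt x,
      forall x, Lt x != 0 -> L x != 0 /\ (\sum_i x i <= theta)%N &
      forall e : I -> nat, (\sum_i e i <= D)%N ->
        \sum_x Lt x * \prod_i (x i)%:R ^+ e i =
        \sum_x L x * \prod_i (x i)%:R ^+ e i].
Proof.
have exS (y : point) : exists S, (theta < \sum_i y i)%N -> heavy S y.
  have [yth|_] := ltnP theta (\sum_i y i); last by exists finset.set0.
  by have [S hS] := heavy_exists yth; exists S.
have [Sof SofP] := choice exS.
pose err x := \sum_(y : point | (theta < \sum_i y i)%N) L y * corr R D (Sof y) y x.
have err_le x : `|err x| <= L x.
  apply: le_trans (ler_norm_sum _ _ _) _.
  pose F (S : {set I}) i (t : nat) : R :=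
    if i \in S then h #|S| t else (x i == t :> nat)%:R.
  have F0 S i t : 0 <= F S i t.
    by rewrite /F; case: ifP.
  (* The set used for y depends on y; summing over all nonempty S removes this dependence and leaves
     products that factor over coordinates. *)
  apply: (@le_trans _ _ (\sum_(y : point) L x *
      \sum_(S : {set I} | (0 < #|S|)%N) \prod_i F S i (y i))).
    rewrite big_mkcond; apply: ler_sum => y _.
    have R0 : 0 <= L x * \sum_(S : {set I} | (0 < #|S|)%N) \prod_i F S i (y i).
      by rewrite mulr_ge0 // sumr_ge0 // => S _; rewrite prodr_ge0.
    case: ifP => // yth; rewrite normrM ger0_norm //.
    have [->|nz] := eqVneq (corr R D (Sof y) y x) 0; first by rewrite normr0 mulr0.
    have hS := SofP y yth; apply: le_trans (corr_cost hS nz) _.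
    rewrite ler_wpM2l //; case/and4P: hS => S0 _ _ _.
    rewrite [X in _ <= X](bigD1 (Sof y)) //= lerDl sumr_ge0 // => S _.
    by rewrite prodr_ge0.
  rewrite -mulr_sumr exchange_big /= ler_piMr //; apply: le_trans tau_tail.
  apply: ler_sum => S S0.
  rewrite -(bigA_distr_bigA (fun i (t : 'I_r.+1) => F S i t)).
  rewrite (eq_bigr (fun i => if i \in S then \sum_(t < r.+1) h #|S| t else 1)).
    rewrite -big_mkcond prodr_const; apply: lerXn2r; rewrite ?nnegrE.
    - exact: sumr_ge0.
    - by rewrite mulr_ge0 // divr_ge0 // ltW ?tau0.
    by rewrite /h -mulr_sumr ler_wpM2l // sum_inv_sq_tail // tau0.
  move=> i _; rewrite /F; case: ifP => // _.
  under eq_bigr do rewrite eq_sym -[_%:R]mulr1.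
  by rewrite (sum_ord_delta (fun=> 1)) // -ltnS.
have err0 (x : point) : (theta < \sum_i x i)%N -> err x = 0.
  move=> xth; rewrite /err big1 // => y yth.
  have [->|nz] := eqVneq (corr R D (Sof y) y x) 0; first by rewrite mulr0.
  by move: xth; rewrite ltnNge (corr_weight (SofP y yth) nz).
pose Lt (x : point) := (if (\sum_i x i <= theta)%N then L x else 0) + err x.
have LtE (x : point) : Lt x = if (\sum_i x i <= theta)%N then L x + err x else 0.
  by rewrite /Lt; case: leqP => // xth; rewrite err0 // addr0.
exists Lt; split.
- move=> x; rewrite LtE; case: ifP => // _.
  by have := err_le x; rewrite ler_norml => /andP[h1 _]; lra.
- move=> x; rewrite LtE; case: ifP => [xth nz|_]; last by rewrite eqxx.
  split=> //; apply: contraNneq nz => Lx0.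
  by have := err_le x; rewrite Lx0 normr_le0 add0r.
move=> e eD; rewrite /Lt.
under eq_bigr do rewrite mulrDl.
rewrite big_split /= [RHS](bigID (fun x : point => (\sum_i x i <= theta)%N)) /=.
congr (_ + _).
  by rewrite [RHS]big_mkcond; apply: eq_bigr => x _; case: ifP; rewrite ?mul0r.
rewrite /err; under eq_bigr do rewrite mulr_suml.
rewrite exchange_big /=; apply: eq_big => [y|y yth]; first by rewrite ltnNge.
under eq_bigr do rewrite -mulrA.
rewrite -mulr_sumr corr_moment // => i iS.
by apply: heavy_pos iS; exact: SofP.
Qed.

End Truncation.

(** * Choice of the thresholds when theta is large *)

Lemma sum_by_card (V : nmodType) (I : finType) (f : nat -> V) :
  \sum_(S : {set I} | (0 < #|S|)%N) f #|S| =
  \sum_(s < #|I|.+1 | (0 < s)%N) f s *+ 'C(#|I|, s).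
Proof.
pose card_ord (S : {set I}) : 'I_#|I|.+1 := inord #|S|.
have cE S : card_ord S = #|S| :> nat by rewrite inordK // ltnS max_card.
rewrite (partition_big card_ord (fun s : 'I_#|I|.+1 => (0 < s)%N)) /=; last first.
  by move=> S; rewrite cE.
apply: eq_bigr => s s0.
rewrite (eq_bigl (mem [set S : {set I} | #|S| == s]%SET)); last first.
  move=> S; rewrite /= inE; apply/andP/eqP => [[_ /eqP <-]|e]; first by rewrite cE.
  by rewrite e s0; split=> //; apply/eqP/val_inj; rewrite /= cE.
rewrite (eq_bigr (fun=> f s)) => [|S]; last by rewrite /= inE => /eqP ->.
by rewrite sumr_const card_draws.
Qed.

Section Numerics.
Variable R : realType.

Lemma expR1_le4 : expR 1 <= 4 :> R.
Proof.
have h : expR (1 / 2) <= 2 :> R by exact: expR_half_le2.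
have -> : 1 = 1 / 2 + 1 / 2 :> R by lra.
have h0 := expR_ge0 (1 / 2 : R).
by rewrite expRD; nra.
Qed.

Lemma ln2_ge : 1 / 2 <= ln 2 :> R.
Proof. by rewrite -ler_expR lnK ?posrE // expR_half_le2. Qed.

Lemma harmonic_le (N : nat) :
  \sum_(1 <= s < N.+2) (s%:R^-1 : R) <= 1 + ln (N.+1)%:R.
Proof.
elim: N => [|N IH]; first by rewrite big_nat1 invr1 ln1 addr0.
rewrite big_nat_recr //=; apply: le_trans (lerD IH (lexx _)) _.
rewrite -addrA lerD2l -lerBrDl.
have p1 : 0 < N.+1%:R :> R by []. have p2 : 0 < N.+2%:R :> R by [].
rewrite -ln_div ?posrE // -lerN2 -lnV ?posrE ?divr_gt0 // invf_div.
have -> : N.+1%:R / N.+2%:R = 1 + (- N.+2%:R^-1) :> R.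
  by rewrite -[N.+2]addn1 natrD; field; rewrite gt_eqF // -natrD addn1.
apply: le_ln1Dx; rewrite ltrN2 invf_lt1 //.
by rewrite ltr1n.
Qed.

(** A single term of (1 + s / N)^N <= exp(s). *)
Lemma bin_exp_le (N s : nat) : (0 < N)%N ->
  'C(N, s)%:R * s%:R ^+ s <= (expR 1 * N%:R) ^+ s :> R.
Proof.
move=> N0; have N0' : 0 < N%:R :> R by rewrite ltr0n.
have [sN|Ns] := leqP s N; last first.
  by rewrite bin_small // mul0r exprn_ge0 // mulr_ge0 // expR_ge0.
have h : 'C(N, s)%:R * (s%:R / N%:R) ^+ s <= expR (s%:R) :> R.
  apply: (@le_trans _ _ ((1 + s%:R / N%:R) ^+ N)).
    rewrite exprDn (bigD1 (inord s)) //= inordK ?ltnS // expr1n mul1r.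
    rewrite -[_ ^+ s *+ _]mulr_natl lerDl; apply: sumr_ge0 => i _.
    by apply: mulrn_wge0; rewrite expr1n mul1r exprn_ge0 // divr_ge0.
  rewrite -[X in expR X](divfK (lt0r_neq0 N0')) expRM_natr.
  by apply: lerXn2r; rewrite ?nnegrE ?expR_ge0 ?addr_ge0 ?divr_ge0 // expR_ge1Dx.
rewrite exprMn -expRM_natr mul1r -ler_pdivrMr ?exprn_gt0 //.
by rewrite -mulrA -exprVn -exprMn.
Qed.

(** By [bin_exp_le] the sets of size s contribute at most (w e |I|)^s <= 2^-s. *)
Lemma tail_sum_le (I : finType) (w : R) : (0 < #|I|)%N -> 0 <= w ->
  w * (expR 1 * #|I|%:R) <= 1 / 2 ->
  \sum_(S : {set I} | (0 < #|S|)%N) (w * #|S|%:R) ^+ #|S| <= 1.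
Proof.
move=> I0 w0 hw; rewrite (sum_by_card I (fun s => (w * s%:R) ^+ s)).
apply: (@le_trans _ _ (\sum_(s < #|I|) (1 / 2) ^+ s.+1)).
  rewrite big_mkcond big_ord_recl /= add0r; apply: ler_sum => s _.
  rewrite /bump leq0n add1n exprMn -[_ *+ 'C(_, _)]mulr_natl mulrCA.
  apply: le_trans (ler_wpM2l (exprn_ge0 _ w0) (bin_exp_le _ I0)) _.
  rewrite -exprMn; apply: lerXn2r; rewrite ?nnegrE //.
  - by rewrite !mulr_ge0 // expR_ge0.
suff -> : \sum_(s < #|I|) (1 / 2) ^+ s.+1 = 1 - (1 / 2) ^+ #|I| :> R.
  by rewrite gerBl exprn_ge0.
elim: {I0 hw} #|I| => [|N IH]; first by rewrite big_ord0 expr0 subrr.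
by rewrite big_ord_recr /= IH exprS; field.
Qed.

End Numerics.

Lemma theta_facts (R : realType) (n m D theta : nat) :
  (0 < n)%N -> (0 < m)%N ->
  128 * tail_const R * (D + n)%:R * m%:R * ln (n + m)%:R <= theta%:R ->
  exists tau : nat -> R,
  [/\ forall s, (0 < s)%N -> 0 < tau s,
      \sum_(1 <= s < #|{: 'I_n * 'I_m}|.+1) tau s <= theta%:R / 2,
      \sum_(S : {set 'I_n * 'I_m} | (0 < #|S|)%N)
        (tail_const R * (2 / tau #|S|)) ^+ #|S| <= 1,
      (16 * (3 * (128 * m))%:R) ^+ D <=
        expR (theta%:R / (4 * (3 * (128 * m))%:R)) :> R &
      (#|{: 'I_n * 'I_m}| + D)%:R <= theta%:R / 2 :> R].
Proof.
move=> n0 m0; set l := ln _ => hth.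
have N1 : (2 <= n + m)%N by lia.
have cN : #|{: 'I_n * 'I_m}| = (n * m)%N by rewrite card_prod !card_ord.
have nm0 : (0 < n * m)%N by rewrite muln_gt0 n0.
have l2 : 1 / 2 <= l.
  apply: le_trans (ln2_ge R) _; rewrite ler_ln ?posrE ?ltr0n //; last lia.
  by rewrite (ler_nat _ 2).
have tc : 256 * 256 <= tail_const R by rewrite /tail_const; lra.
move: (tail_const R) tc hth => T tc hth.
have T0 : 0 < T by lra.
have mR : 1 <= m%:R :> R by rewrite ler1n.
have nR : 1 <= n%:R :> R by rewrite ler1n.
have DR : 0 <= D%:R :> R by [].
set k : R := (D + n)%:R; have kE : k = D%:R + n%:R by rewrite /k natrD.
rewrite -/k in hth.
have k1 : 1 <= k by lra.
set q := k * m%:R * l.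
have hq : 128 * T * q <= theta%:R by move: hth; rewrite /q !mulrA.
have q0 : 1 / 2 <= q.
  have : 1 <= k * m%:R by clear - k1 mR; nra.
  by rewrite /q; move: (k * m%:R) => u u1; clear - u1 l2; nra.
have q0' : 0 < q by lra.
have th0 : 0 < theta%:R :> R.
  by apply: lt_le_trans hq; rewrite mulr_gt0 // mulr_gt0.
set H := \sum_(1 <= s < (n * m).+1) (s%:R^-1 : R).
have H0 : 0 < H.
  rewrite /H big_ltn ?ltnS // invr1; apply: ltr_pwDl => //.
  by apply: sumr_ge0 => s _; rewrite invr_ge0.
have H4 : H <= 4 * l.
  rewrite /H -(prednK nm0); apply: le_trans (harmonic_le R _) _.
  rewrite prednK // natrM lnM ?posrE ?ltr0n //.
  have ln_n : ln n%:R <= l by rewrite ler_ln ?posrE ?ltr0n ?ler_nat ?addn_gt0 ?n0 ?leq_addr.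
  have ln_m : ln m%:R <= l by rewrite ler_ln ?posrE ?ltr0n ?ler_nat ?addn_gt0 ?n0 ?leq_addl.
  by lra.
(* Thresholds proportional to 1 / s with sum theta / 2. Then [tail_const] * 2 / tau s is linear in
   s, as [tail_sum_le] requires, and H <= 4 ln(n + m) is the price. *)
exists (fun s => theta%:R / (2 * H) / s%:R); split.
- by move=> s s0; rewrite divr_gt0 ?(ltr0n _ s) // divr_gt0 // mulr_gt0.
- rewrite cN -mulr_sumr -/H le_eqVlt; apply/orP; left; apply/eqP.
  by field; rewrite gt_eqF.
- pose w := T * (4 * H / theta%:R).
  rewrite (eq_bigr (fun S : {set 'I_n * 'I_m} => (w * #|S|%:R) ^+ #|S|)).
    apply: tail_sum_le; first by rewrite cN.
      by rewrite ltW // mulr_gt0 // divr_gt0 // mulr_gt0.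
    rewrite cN natrM.
    apply: (@le_trans _ _ (T * (4 * (4 * l) / theta%:R) * (4 * (n%:R * m%:R)))).
      apply: ler_pM; last by rewrite ler_wpM2r ?mulr_ge0 // expR1_le4.
      - by rewrite ltW // mulr_gt0 // divr_gt0 // mulr_gt0.
      - by rewrite !mulr_ge0 // expR_ge0.
      rewrite ler_wpM2l //; first lra.
      by rewrite ler_wpM2r ?invr_ge0 ?ler_wpM2l // ltW.
    have -> : T * (4 * (4 * l) / theta%:R) * (4 * (n%:R * m%:R)) =
       64 * T * (n%:R * m%:R * l) / theta%:R by ring.
    rewrite ler_pdivrMr //.
    have nq : n%:R * m%:R * l <= q.
      rewrite /q ler_wpM2r //; first lra.
      by rewrite ler_wpM2r //; lra.
    have := ler_wpM2l (_ : 0 <= 64 * T) nq => /(_ (ltac:(lra))).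
    by lra.
  move=> S S0; congr (_ ^+ _); rewrite /w.
  have nzS : #|S|%:R != 0 :> R by rewrite pnatr_eq0 -lt0n.
  have nzH : H != 0 by rewrite gt_eqF.
  have nzt : theta%:R != 0 :> R by rewrite gt_eqF.
  by field; rewrite ?nzS ?nzH ?nzt.
- set b : R := (3 * (128 * m))%:R.
  have bE : b = 384 * m%:R by rewrite /b !natrM; ring.
  (* 16 * 384 * m <= 2^13 m <= (n + m)^14. *)
  apply: (@le_trans _ _ (expR (14 * l * D%:R))).
    rewrite expRM_natr; apply: lerXn2r; rewrite ?nnegrE ?expR_ge0 //.
      by rewrite mulr_ge0 // ler0n.
    rewrite expRM_natl lnK ?posrE ?ltr0n ?addn_gt0 ?n0 //.
    rewrite bE exprS.
    apply: (@le_trans _ _ (m%:R * 2 ^+ 13)).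
      by rewrite -[2 ^+ 13]/(2 ^+ (6 + 7)) exprD; nra.
    apply: ler_pM => //; first by rewrite ler_nat leq_addl.
    by apply: lerXn2r; rewrite ?nnegrE // (ler_nat _ 2).
  rewrite ler_expR ler_pdivlMr; last by rewrite mulr_gt0 // ltr0n !muln_gt0 m0.
  apply: le_trans hq; rewrite bE.
  have -> : 14 * l * D%:R * (4 * (384 * m%:R)) = 14 * 4 * 384 * (D%:R * m%:R * l) by ring.
  have Dq : D%:R * m%:R * l <= q.
    rewrite /q ler_wpM2r //; first lra.
    by rewrite ler_wpM2r //; lra.
  have : 128 * (256 * 256) * q <= 128 * T * q.
    by rewrite ler_wpM2r ?ler_wpM2l //; lra.
  by lra.
- rewrite cN natrD natrM.
  have h1 : n%:R * m%:R + D%:R <= k * m%:R.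
    by rewrite kE mulrDl addrC lerD2r ler_peMr.
  have h2 : k * m%:R * (1 / 2) <= q by rewrite /q ler_wpM2l // mulr_ge0.
  have : 128 * (256 * 256) * q <= 128 * T * q.
    by rewrite ler_wpM2r ?ler_wpM2l //; lra.
  by lra.
Qed.

(** * Pulling an approximant back to the cube *)

Lemma convex_comb (R : realType) (I : Type) (s : seq I) (w v : I -> R) (A : set R^o) :
  convex_set A -> (forall i, 0 <= w i) -> (forall i, w i != 0 -> A (v i)) ->
  0 < \sum_(i <- s) w i ->
  A ((\sum_(i <- s) w i * v i) / \sum_(i <- s) w i).
Proof.
move=> cA w0 wA; elim: s => [|i s IH]; first by rewrite big_nil ltxx.
rewrite !big_cons; set W := \sum_(j <- s) w j; set V := \sum_(j <- s) _ => pos.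
have W0 : 0 <= W by apply: sumr_ge0.
have [Wz|Wnz] := eqVneq W 0.
  have Vz : V = 0.
    rewrite /V; move: Wz; rewrite /W; elim: s {IH W0 pos W V} => [|j s IHs].
      by rewrite !big_nil.
    rewrite !big_cons => /eqP; rewrite paddr_eq0 ?sumr_ge0 // => /andP[/eqP -> /eqP h].
    by rewrite mul0r add0r IHs.
  rewrite Wz addr0 in pos *; rewrite Vz addr0 mulrC mulKf ?gt_eqF //.
  by apply: wA; rewrite gt_eqF.
have Wp : 0 < W by rewrite lt0r Wnz.
have IH' := IH Wp.
have [wz|wnz] := eqVneq (w i) 0; first by rewrite wz mul0r !add0r.
have wp : 0 < w i by rewrite lt0r wnz w0.
have l0 : 0 <= w i / (w i + W) by rewrite divr_ge0 // ltW.
have l1 : w i / (w i + W) <= 1 by rewrite ler_pdivrMr // mul1r lerDl.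
have := cA (v i) (V / W) (Itv01 l0 l1).
rewrite !inE => /(_ (wA _ wnz) IH').
have -> : (w i * v i + V) / (w i + W) =
    w i / (w i + W) * v i + (1 - w i / (w i + W)) * (V / W).
  by field; rewrite Wnz gt_eqF.
exact: id.
Qed.

Section Blocks.
Variables (R : realType) (n m r : nat).
Notation bpoint := {ffun 'I_m -> 'I_r.+1}.
Notation point := {ffun 'I_n * 'I_m -> 'I_r.+1}.

Definition blk (y : point) (i : 'I_n) : bpoint := [ffun j => y (i, j)].

Lemma sum_blocks (G : 'I_n -> bpoint -> R) :
  \sum_(y : point) \prod_i G i (blk y i) = \prod_i \sum_(b : bpoint) G i b.
Proof.
rewrite bigA_distr_bigA.
pose unc (g : {ffun 'I_n -> bpoint}) : point := [ffun p => g p.1 p.2].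
rewrite (reindex unc) /=; last first.
  apply: onW_bij; exists (fun y : point => [ffun i => blk y i]) => [g|y].
    by apply/ffunP => i; apply/ffunP => j; rewrite !ffunE.
  by apply/ffunP => -[i j]; rewrite !ffunE.
apply: eq_bigr => g _; apply: eq_bigr => i _; congr (G i _).
by apply/ffunP => j; rewrite !ffunE.
Qed.

Lemma sum_blocks_moment (G : 'I_n -> bpoint -> R) (e : 'I_n * 'I_m -> nat) :
  \sum_(y : point) (\prod_i G i (blk y i)) * \prod_p (y p)%:R ^+ e p =
  \prod_i \sum_(b : bpoint) G i b * \prod_j (b j)%:R ^+ e (i, j).
Proof.
rewrite -sum_blocks; apply: eq_bigr => y _; rewrite big_split /=; congr (_ * _).
rewrite (pair_bigA _ (fun i j => (blk y i j)%:R ^+ e (i, j))) /=.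
by apply: eq_bigr => -[i j] _; rewrite ffunE.
Qed.

Lemma movable_blocks (lo hi : nat -> R) (G : 'I_n -> bpoint -> R) :
  (forall t, 0 <= lo t) -> (forall i b, 0 <= G i b) ->
  (forall i, movable lo hi (G i)) ->
  movable lo hi (fun y : point => \prod_i G i (blk y i)).
Proof.
move=> lo0 G0 mv S x y xy pos.
have splitS (F : 'I_n * 'I_m -> R) :
    \prod_(p in S) F p = \prod_i \prod_(j in [set j | (i, j) \in S]%SET) F (i, j).
  rewrite big_mkcond /=; under [RHS]eq_bigr do rewrite big_mkcond /=.
  rewrite (pair_bigA _ (fun i j => if j \in [set j | (i, j) \in S]%SET then F (i, j) else 1)) /=.
  by apply: eq_bigr => -[i j] _; rewrite inE.
rewrite !splitS -!big_split /=; apply: ler_prod => i _; apply/andP; split.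
  by rewrite mulr_ge0 // prodr_ge0.
have := mv i [set j | (i, j) \in S]%SET (blk x i) (blk y i).
have E (u : point) (f : nat -> R) : \prod_(j in [set j | (i, j) \in S]%SET) f (u (i, j)) =
   \prod_(j in [set j | (i, j) \in S]%SET) f (blk u i j).
  by apply: eq_bigr => j _; rewrite ffunE.
rewrite !E; apply.
- by move=> j; rewrite inE => ijS; rewrite !ffunE xy.
- by move=> j; rewrite inE => ijS; rewrite !ffunE; exact: pos.
Qed.

End Blocks.

Section Evaluation.
Variables (R : realType) (n m r : nat).
Notation point := {ffun 'I_n * 'I_m -> 'I_r.+1}.

Definition row_of (y : point) : 'rV['I_r.+1]_(n * m) :=
  mxvec (\matrix_(i, j) y (i, j)).

Definition mexp (mon : mpoly.multinom (n * m)) (p : 'I_n * 'I_m) : nat :=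
  mpoly.fun_of_multinom mon (mxvec_index p.1 p.2).

Lemma meval_row_of (y : point) (p : mpoly.mpoly (n * m) R) :
  mpoly.meval (map_mx (@ord_val R r.+1) (row_of y) 0) p =
  \sum_(mon <- mpoly.msupp p) mpoly.mcoeff mon p *
     \prod_k (y k)%:R ^+ mexp mon k.
Proof.
rewrite mpoly.mevalE; apply: eq_bigr => mon _; congr (_ * _).
rewrite (reindex _ (curry_mxvec_bij _ _)) /=.
by apply: eq_bigr => -[i j] _; rewrite /mexp /= !mxE mxvecE mxE.
Qed.

Lemma sum_mexp (p : mpoly.mpoly (n * m) R) (mon : mpoly.multinom (n * m)) :
  mon \in mpoly.msupp p -> (\sum_k mexp mon k <= totdeg p)%N.
Proof.
move=> /mpoly.msize_mdeg_lt; rewrite mpoly.mdegE (reindex _ (curry_mxvec_bij _ _)) /=.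
rewrite /totdeg => h; rewrite -ltnS (ltn_predK h); apply: leq_ltn_trans h.
by rewrite leq_eqVlt; apply/orP; left; apply/eqP; apply: eq_bigr => -[i j] _.
Qed.

Lemma weight_row_of (y : point) (theta : nat) :
  (row_of y \in weight_le r.+1 (n * m) theta) = (\sum_k y k <= theta)%N.
Proof.
rewrite inE (reindex _ (curry_mxvec_bij _ _)) /=; congr (_ <= _)%N.
by apply: eq_bigr => -[i j] _; rewrite mxvecE mxE.
Qed.

End Evaluation.

(** A monomial of degree below |U| (d + 1) has degree at most d in some block of U, and the factor
    of that block vanishes. *)
Lemma sum_blocks_orth (R : realType) (n m r d D : nat)
    (G : 'I_n -> {ffun 'I_m -> 'I_r.+1} -> R) (U : {set 'I_n})
    (e : 'I_n * 'I_m -> nat) :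
  (forall i, i \in U -> forall c : 'I_m -> nat, (\sum_j c j <= d)%N ->
    \sum_b G i b * \prod_j (b j)%:R ^+ c j = 0) ->
  (\sum_p e p <= D)%N -> (D < #|U| * d.+1)%N ->
  \sum_(y : {ffun 'I_n * 'I_m -> 'I_r.+1})
    (\prod_i G i (blk y i)) * \prod_p (y p)%:R ^+ e p = 0.
Proof.
move=> orth eD DU; rewrite sum_blocks_moment.
case: (pickP (fun i => (i \in U) && (\sum_j e (i, j) <= d)%N)) => [i /andP[iU ei]|none].
  by rewrite (bigD1 i) //= (orth i iU (fun j => e (i, j))) // mul0r.
suff h : (#|U| * d.+1 <= \sum_p e p)%N by move: DU; rewrite ltnNge (leq_trans h eD).
rewrite (eq_bigr (fun p => e (p.1, p.2))); last by case.
rewrite -(pair_bigA _ (fun i j => e (i, j))) /= -sum_nat_const big_mkcond /=.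
apply: leq_sum => i _; case: ifP => // iU.
by have := none i; rewrite iU /= => /negbT; rewrite -ltnNge.
Qed.

Section Transfer.
Variables (R : realType) (n m theta : nat) (I0 I1 Is : set R^o).
Variables (f : 'rV[bool]_n -> option bool) (g : 'rV['I_(m ^ 2).+1]_m -> bool).
Notation bpoint := {ffun 'I_m -> 'I_(m ^ 2).+1}.
Notation point := {ffun 'I_n * 'I_m -> 'I_(m ^ 2).+1}.
Variables (L : bool -> bpoint -> R) (p : mpoly.mpoly (n * m) R).

Hypothesis n0 : (0 < n)%N.
Hypothesis m0 : (0 < m)%N.
Hypotheses (cI0 : convex_set I0) (cI1 : convex_set I1) (cIs : convex_set Is).
Hypothesis L0 : forall b y, 0 <= L b y.
Hypothesis L1 : forall b, \sum_y L b y = 1.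
Hypothesis Lg : forall b y, L b y != 0 -> g (\row_j y j) = b.
Hypothesis Lmov : forall b, movable (base_lo R) (fun t => 3 * base_hi R m t) (L b).
Hypothesis Lorth : forall e : 'I_m -> nat, (\sum_i e i <= m %/ 128)%N ->
  \sum_y L true y * \prod_i (y i)%:R ^+ e i =
  \sum_y L false y * \prod_i (y i)%:R ^+ e i.
Hypothesis pP : approximant I0 I1 Is (@ord_val R (m ^ 2).+1)
  (weight_le (m ^ 2).+1 (n * m) theta) (block_comp f g) p.
Hypothesis thetaP : 128 * tail_const R * (totdeg p + n)%:R * m%:R *
  ln (n + m)%:R <= theta%:R.

Let D := totdeg p.
Let d := (m %/ 128)%N.
Let ev (y : point) : R := mpoly.meval (map_mx (@ord_val R (m ^ 2).+1) (row_of y) 0) p.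

Let Lz (z : 'rV[bool]_n) (y : point) : R := \prod_i L (z 0 i) (blk y i).

Let G (U : {set 'I_n}) (i : 'I_n) (b : bpoint) : R :=
  if i \in U then L true b - L false b else L false b.

Let coef (U : {set 'I_n}) : R := \sum_y (\prod_i G U i (blk y i)) * ev y.

Let mon (U : {set 'I_n}) : mpoly.multinom n :=
  mpoly.Multinom [tuple (i \in U : nat) | i < n].

(** The expectation of p under L_z expanded in z, where U is the set of blocks contributing L_1 -
    L_0. The omitted coefficients are zero by [coef_eq0]; omitting them makes the degree bound
    visible. *)
Let q : mpoly.mpoly n R :=
  \sum_(U : {set 'I_n} | (#|U| * d.+1 <= D)%N) coef U *: mpoly.mpolyX R (mon U).

Let sum_ev (H : point -> R) : \sum_y H y * ev y =
  \sum_(mo <- mpoly.msupp p) mpoly.mcoeff mo p *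
    \sum_y H y * \prod_k (y k)%:R ^+ mexp mo k.
Proof.
rewrite /ev; under eq_bigr do rewrite meval_row_of mulr_sumr.
rewrite exchange_big /=; apply: eq_bigr => mo _; rewrite mulr_sumr.
by apply: eq_bigr => y _; rewrite mulrCA.
Qed.

Let coef_eq0 (U : {set 'I_n}) : (D < #|U| * d.+1)%N -> coef U = 0.
Proof.
move=> DU; rewrite /coef sum_ev big_seq big1 // => mo mop.
rewrite (@sum_blocks_orth R n m (m ^ 2) d D (G U) U) ?mulr0 //; last exact: sum_mexp.
move=> i iU c cd; rewrite /G iU.
under eq_bigr do rewrite mulrBl.
by rewrite sumrB Lorth // subrr.
Qed.

Let monE (U : {set 'I_n}) i : mpoly.fun_of_multinom (mon U) i = (i \in U) :> nat.
Proof. by rewrite mpoly.mnmE. Qed.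

Let q_deg : (totdeg q * d.+1 <= D)%N.
Proof.
rewrite -leq_divRL // /totdeg.
suff : (mpoly.msize q <= (D %/ d.+1).+1)%N by case: (mpoly.msize q).
apply: leq_trans (mpoly.msize_sum _ _ _) _; apply/bigmax_leqP => U UD.
apply: leq_trans (mpoly.msizeZ_le _ _) _; rewrite mpoly.msizeX ltnS leq_divRL //.
rewrite (_ : mpoly.mdeg _ = #|U|) // mpoly.mdegE -sum1_card [RHS]big_mkcond /=.
by apply: eq_bigr => i _; rewrite monE; case: (i \in U).
Qed.

Let q_eval (z : 'rV[bool]_n) :
  mpoly.meval (map_mx (@bool_val R) z 0) q = \sum_y Lz z y * ev y.
Proof.
have -> : mpoly.meval (map_mx (@bool_val R) z 0) q =
    \sum_(U : {set 'I_n}) coef U * \prod_i (z 0 i)%:R ^+ (i \in U).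
  rewrite raddf_sum /= [RHS](bigID (fun U : {set 'I_n} => (#|U| * d.+1 <= D)%N)) /=.
  rewrite [X in _ = _ + X]big1 ?addr0.
    apply: eq_bigr => U _; rewrite mpoly.mevalZ mpoly.mevalX; congr (_ * _).
    by apply: eq_bigr => i _; rewrite monE mxE.
  by move=> U; rewrite -ltnNge => /coef_eq0 ->; rewrite mul0r.
rewrite /coef; under eq_bigr do rewrite mulr_suml.
rewrite exchange_big /=; apply: eq_bigr => y _.
transitivity (\sum_(U : {set 'I_n}) (\prod_i (if i \in U
    then (z 0 i)%:R * (L true (blk y i) - L false (blk y i))
    else L false (blk y i))) * ev y).
  apply: eq_bigr => U _; rewrite mulrAC -big_split /=; congr (_ * _).
  apply: eq_bigr => i _; rewrite /G; case: ifP => _; last by rewrite expr0 mulr1.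
  by rewrite expr1 mulrC.
rewrite -mulr_suml; congr (_ * _).
rewrite -(@bigA_distr R 0 1 _ _ _
  (fun i => (z 0 i)%:R * (L true (blk y i) - L false (blk y i)))
  (fun i => L false (blk y i))) /=.
apply: eq_bigr => i _; case: (z 0 i); rewrite ?mul1r ?mul0r ?add0r //.
by rewrite subrK.
Qed.

Let target_convex o : convex_set (target I0 I1 Is o : set R^o).
Proof. by case: o => [[]|]. Qed.

Lemma transfer : exists2 q : mpoly.mpoly n R,
  approximant I0 I1 Is (@bool_val R) [set: 'rV[bool]_n]%SET f q &
  (totdeg q * (m %/ 128).+1 <= totdeg p)%N.
Proof.
exists q; last exact: q_deg.
move=> z _; rewrite q_eval.
have Lz0 y : 0 <= Lz z y by apply: prodr_ge0.
have Lzmov : movable (base_lo R) (fun t => 3 * base_hi R m t) (Lz z).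
  apply: (@movable_blocks R n m (m ^ 2) _ _ (fun i => L (z 0 i))) => // t.
  by rewrite ltW // base_lo_gt0.
have [tau [tau0 tau_sum tau_tail th_exp th_ge]] := theta_facts n0 m0 thetaP.
have [Lt [Lt0 Ltsupp Ltmom]] :=
  truncation m0 Lz0 Lzmov tau0 tau_sum tau_tail th_exp th_ge.
(* Every monomial of p has degree at most D, and [Lt] keeps these moments. *)
have -> : \sum_y Lz z y * ev y = \sum_y Lt y * ev y.
  rewrite !sum_ev big_seq [RHS]big_seq; apply: eq_bigr => mo mop.
  by rewrite Ltmom // sum_mexp.
have Lt1 : \sum_y Lt y = 1.
  have := Ltmom (fun=> 0%N); rewrite big1 // => /(_ (leq0n _)).
  have E (H : point -> R) : \sum_y H y * \prod_k (y k)%:R ^+ 0 = \sum_y H y.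
    by apply: eq_bigr => y _; rewrite big1 ?mulr1.
  rewrite !E => ->; rewrite (@sum_blocks R n m (m ^ 2) (fun i => L (z 0 i))).
  by rewrite big1.
rewrite -[X in target _ _ _ _ X]divr1 -[X in _ / X]Lt1.
apply: (@convex_comb R point _ Lt ev (target I0 I1 Is (f z))) => //; last by rewrite Lt1.
move=> y /Ltsupp[Lznz yth].
have zE : f z = block_comp f g (row_of y).
  rewrite /block_comp; congr f; apply/rowP => i; rewrite mxE; apply/esym.
  have Lnz : L (z 0 i) (blk y i) != 0.
    by apply: contraNneq Lznz => Li; rewrite /Lz (bigD1 i) //= Li mul0r.
  rewrite -(Lg Lnz); congr g; apply/rowP => j.
  by rewrite /row_of mxvecK !mxE ffunE.
rewrite zE; apply: pP; by rewrite weight_row_of.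
Qed.

End Transfer.

(** * The lower bound for both compositions *)

Lemma degree_bound (R : realType) (n m theta : nat) (f : 'rV[bool]_n -> option bool)
    (I0 I1 Is : set R^o) (s : bool -> bool) (g : 'rV['I_(m ^ 2).+1]_m -> bool) :
  let c := (128 * tail_const R)^-1 in
  (0 < n)%N -> (0 < m)%N -> I0 !=set0 -> I1 !=set0 -> Is !=set0 ->
  convex_set I0 -> convex_set I1 -> convex_set Is ->
  involutive s -> (forall t, g t = s (MPstar t)) ->
  Num.min (c * m%:R * (deg_cube I0 I1 Is f)%:R)
          (c * theta%:R / (m%:R * log2 (n + m)%:R) - n%:R) <=
    (deg_le I0 I1 Is theta (block_comp f g))%:R.
Proof.
move=> c n0 m0 e0 e1 es c0 c1 cs sK gE.
have [[p pP pd] _] := approx_degP (weight_le (m ^ 2).+1 (n * m) theta)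
  (block_comp f g) (@ord_val_inj R (m ^ 2).+1) e0 e1 es.
rewrite /deg_le -pd; set D := totdeg p.
have [[_ _ _] qmin] := approx_degP [set: 'rV[bool]_n]%SET f (@bool_val_inj R) e0 e1 es.
have tc : 256 * 256 <= tail_const R by rewrite /tail_const; lra.
have T0 : 0 < tail_const R by apply: lt_le_trans tc; lra.
have c0' : 0 < c by rewrite invr_gt0 mulr_gt0.
have c128 : c * 128 <= 1 by rewrite /c mulrC ler_pdivrMr ?mulr_gt0 // mul1r; lra.
have l0 : 0 < ln (n + m)%:R :> R.
  have h : ln 2 <= ln (n + m)%:R :> R.
    by rewrite ler_ln ?posrE ?ltr0n ?addn_gt0 ?n0 // (ler_nat _ 2) -addn1 leq_add.
  by apply: lt_le_trans h; apply: lt_le_trans (ln2_ge R); lra.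
have [le|lt] := leP (c * theta%:R / (m%:R * log2 (n + m)%:R) - n%:R) D%:R.
  by rewrite ge_min le orbT.
rewrite ge_min; apply/orP; left.
have thetaP : 128 * tail_const R * (D + n)%:R * m%:R * ln (n + m)%:R <= theta%:R.
  have m0' : 0 < m%:R :> R by rewrite ltr0n.
  have ln2_0 : 0 < ln 2 :> R by apply: lt_le_trans (ln2_ge R); lra.
  (* Hence the base 2 logarithm dominates the natural one used in [transfer]; the n added to D comes
     from the term -n of the bound. *)
  have ln2_1 : ln 2 <= 1 :> R.
    by rewrite (_ : 2 = 1 + 1) // le_ln1Dx // (lt_trans _ ltr01) // oppr_lt0.
  move: lt; rewrite ltrBrDr -natrD ltr_pdivlMr; last by rewrite mulr_gt0 // divr_gt0.
  rewrite /c -(mulrC theta%:R) ltr_pdivlMr ?mulr_gt0 // => /ltW; apply: le_trans.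
  rewrite /log2; set k := (D + n)%:R; set l := ln _.
  rewrite [X in X <= _](_ : _ = k * (m%:R * l) * (128 * tail_const R)); last by ring.
  have cT : 0 <= 128 * tail_const R by rewrite mulr_ge0 // ltW.
  rewrite (ler_wpM2r cT) // ler_wpM2l // ler_wpM2l // ler_pdivlMr //.
  by rewrite ger_pMr.
have [L [L0 L1 Lg Lmov Lorth]] := block_dual R m0.
have [q qP qD] : exists2 q : mpoly n R,
    approximant I0 I1 Is (@bool_val R) [set: 'rV[bool]_n]%SET f q &
    (totdeg q * (m %/ 128).+1 <= D)%N.
  (* For the negated block the roles of L_0 and L_1 are exchanged, which their symmetric moment
     identity allows. *)
  apply: (@transfer R n m theta I0 I1 Is f g (fun b => L (s b)) p) => //.
  - move=> b y nz; rewrite gE -[RHS]sK -(Lg _ _ nz); congr s.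
    by apply: eq_forallb => i; rewrite mxE.
  - by move=> e ed; case: (s true) (s false) => -[]; rewrite ?(Lorth e ed).
have degq : (deg_cube I0 I1 Is f <= totdeg q)%N by exact: qmin.
have h : (deg_cube I0 I1 Is f * (m %/ 128).+1 <= D)%N.
  by apply: leq_trans qD; rewrite leq_mul2r degq orbT.
have hm : (m <= 128 * (m %/ 128).+1)%N by rewrite mulnC ltnW // ltn_ceil.
have hR : m%:R * (deg_cube I0 I1 Is f)%:R <= 128 * D%:R :> R.
  rewrite -!natrM ler_nat; apply: leq_trans (leq_mul hm (leqnn _)) _.
  by rewrite -mulnA leq_mul2l mulnC h orbT.
rewrite -mulrA; apply: le_trans (ler_wpM2l (ltW c0') hR) _.
by rewrite mulrA ler_piMl.
Qed.

Theorem theorem4p6 (R : realType) :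
  exists c : R, 0 < c < 1 /\
  forall (n m theta : nat) (f : 'rV[bool]_n -> option bool)
    (I0 I1 Is : set R^o),
    (0 < n)%N -> (0 < m)%N -> (0 < theta)%N ->
    I0 !=set0 -> I1 !=set0 -> Is !=set0 ->
    convex_set I0 -> convex_set I1 -> convex_set Is ->
    let bound : R :=
      Num.min (c * m%:R * (deg_cube I0 I1 Is f)%:R)
              (c * theta%:R / (m%:R * log2 (n + m)%:R) - n%:R) in
    (bound <= (deg_le I0 I1 Is theta (block_comp f (@MPstar m)))%:R) /\
    (bound <= (deg_le I0 I1 Is theta (block_comp f (@negMPstar m)))%:R).
Proof.
have tc : 256 * 256 <= tail_const R by rewrite /tail_const; lra.
exists (128 * tail_const R)^-1; split.
  rewrite invr_gt0 invf_lt1; first by apply/andP; split; lra.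
  by lra.
move=> n m theta f I0 I1 Is n0 m0 _ e0 e1 es c0 c1 cs bound.
split; first exact: (@degree_bound R n m theta f I0 I1 Is id).
exact: (@degree_bound R n m theta f I0 I1 Is negb _ _ _ _ _ _ _ _ _ negbK).
Qed.
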